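(* Let $\beta\in B$ and assume $\Theta_\beta\neq\emptyset$. Then for every $a\in\mathbb R^d$ with $K_\beta^*(a)$ finite there exists a unique (up to $\mu$-a.e. equality) $\mathcal Z$-measurable function $h_a$ such that $$K_\beta^*(a)-\big[\langle\vartheta,a\rangle-K_\beta(\vartheta)\big]\ \ge\ B_\beta(h_a,f_\vartheta),\qquad \vartheta\in\Theta_\beta.$$
   Context: Setting. $(Z,\mathcal Z)$ is a measurable space with a $\sigma$-finite measure $\mu$, and $\varphi\colon Z\to\mathbb R^d$ is $\mathcal Z$-measurable (the moment mapping). $\Gamma$ is the class of functions $\gamma\colon\mathbb R\to(-\infty,+\infty]$ that are finite and strictly convex on $(0,+\infty)$, equal to $+\infty$ for $t<0$, and satisfy $\gamma(0)=\lim_{t\downarrow0}\gamma(t)$. For $\gamma\in\Gamma$, $\gamma'_\pm(t)$ are the right/left derivatives at $t>0$, $\gamma'_-(0)=-\infty$, $\gamma'_+(0)=\lim_{t\downarrow0}\gamma'_+(t)$. $B$ is the class of functions $\beta\colon Z\times\mathbb R\to(-\infty,+\infty]$ such that $\beta(\cdot,t)$ is $\mathcal Z$-measurable for each $t$ and $\beta(z,\cdot)\in\Gamma$ for each $z$. $\mathrm{sgn}(r)$ is the symbol $+$ if $r\ge0$ and $-$ if $r<0$. Convention: an integral whose positive and negative parts are both infinite equals $+\infty$. $\beta^*(z,r)=\sup_t[rt-\beta(z,t)]$, $(\beta^* )'(z,\cdot)$ is its derivative in $r$; $K_\beta(\vartheta)=\int_Z\beta^*(z,\langle\vartheta,\varphi(z)\rangle)\,\mu(dz)$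 for $\vartheta\in\mathbb R^d$; $K_\beta^*(a)=\sup_{\vartheta\in\mathbb R^d}[\langle\vartheta,a\rangle-K_\beta(\vartheta)]$. $\Theta_\beta$ is the set of $\vartheta\in\mathbb R^d$ with $K_\beta(\vartheta)<+\infty$ such that for $\mu$-a.a. $z\in Z$ the function $r\mapsto\beta^*(z,r)$ is finite in a neighborhood of $\langle\vartheta,\varphi(z)\rangle$. The condition $\Theta_\beta\ne\emptyset$ is called the dual constraint qualification (DCQ). $f_\vartheta(z)=(\beta^* )'(z,\langle\vartheta,\varphi(z)\rangle)$ if $\beta^*(z,\cdot)$ is differentiable at $\langle\vartheta,\varphi(z)\rangle$, and $f_\vartheta(z)=0$ otherwise. Bregman distance. For $\gamma\in\Gamma$ and $s,t\ge0$ let $\Delta_\gamma(s,t)=\gamma(s)-\gamma(t)-\gamma'_{\mathrm{sgn}(s-t)}(t)[s-t]$ if $\gamma'_+(t)$ is finite, and $\Delta_\gamma(s,0)=s\cdot(+\infty)$ otherwise (with $0\cdot\infty=0$); $\Delta_\gamma(s,t)=+\infty$ if $s<0$ or $t<0$. For $\mathcal Z$-measurable $g,h$: $B_\beta(g,h)=\int_Z\Delta_{\beta(z,\cdot)}(g(z),h(z))\,\mu(dz)$. *)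

(* Defs.v *)
From HB Require Import structures.
From mathcomp Require Import all_boot all_order all_algebra.
From mathcomp Require Import all_classical all_reals all_analysis.
From mathcomp Require Import measurable_realfun.
Set Implicit Arguments.
Unset Strict Implicit.
Unset Printing Implicit Defensive.
Import Order.TTheory GRing.Theory Num.Theory.
Import numFieldNormedType.Exports.

Local Open Scope classical_set_scope.
Local Open Scope ring_scope.
Local Open Scope ereal_scope.

Section one_variable.
Context {R : realType}.
Implicit Types (g : R -> \bar R) (r s t : R).

(* The class Gamma; [Gamma_ltNy] says that the codomain is (-oo, +oo]. *)
Record Gamma g : Prop := {
  Gamma_ltNy : forall t, -oo < g t ;
  Gamma_fin : forall t, (0 < t)%R -> g t \is a fin_num ;
  Gamma_strictly_convex : forall s t l : R,
    (0 < s)%R -> (0 < t)%R -> s != t -> (0 < l < 1)%R ->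
    g (l * s + (1 - l) * t)%R < l%:E * g s + (1 - l)%:E * g t ;
  Gamma_neg : forall t, (t < 0)%R -> g t = +oo ;
  Gamma_at0 : g t @[t --> (0 : R)^'+] --> g 0%R
}.

(* One-sided derivatives on [0, +oo[, with values in \bar R. For t > 0 they are
   limits of difference quotients; at 0 the conventions g'_+(0) = g'_+(0+) and
   g'_-(0) = -oo apply. Values at t < 0 are junk. *)
Definition diff_quot g t (e : R) : \bar R := (g (t + e)%R - g t) * (e^-1)%:E.

Definition right_deriv g t : \bar R :=
  if t == 0%R then
    lim ((lim (diff_quot g u e @[e --> (0 : R)^'+])) @[u --> (0 : R)^'+])
  else lim (diff_quot g t e @[e --> (0 : R)^'+]).

Definition left_deriv g t : \bar R :=
  if t == 0%R then -oo else lim (diff_quot g t e @[e --> (0 : R)^'-]).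

(* g'_{sgn(r)}(t), where sgn(r) is + if r >= 0 and - if r < 0. *)
Definition sgn_deriv g r t : \bar R :=
  if (0 <= r)%R then right_deriv g t else left_deriv g t.

(* If g'_+(t) is infinite then t = 0, and the distance is s * (+oo), with the
   convention 0 * oo = 0 of mule. *)
Definition bregman g s t : \bar R :=
  if (s < 0)%R || (t < 0)%R then +oo
  else if right_deriv g t \is a fin_num then
    g s - g t - sgn_deriv g (s - t) t * (s - t)%:E
  else s%:E * +oo.

Definition econj g r : \bar R := ereal_sup [set (r * t)%:E - g t | t in setT].

Definition fin_near g r : Prop := \forall s \near r, g s \is a fin_num.

Definition differentiable_at g r : Prop :=
  fin_near g r /\ derivable (fine \o g) r 1.

Definition ederiv g r : R := derive1 (fine \o g) r.

End one_variable.

Definition dot {R : realType} {n : nat} (u v : 'rV[R]_n) : R :=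
  (\sum_(i < n) u 0 i * v 0 i)%R.

Section integral_functionals.
Context {d : measure_display} {Z : measurableType d} {R : realType}.
Variable mu : {measure set Z -> \bar R}.

(* The library integral gives -oo when the positive and negative parts are both
   infinite; here the value is +oo. *)
Definition uintegral (f : Z -> \bar R) : \bar R :=
  if \int[mu]_z f^\+ z == +oo then +oo else \int[mu]_z f z.

Record Bclass (beta : Z -> R -> \bar R) : Prop := {
  Bclass_measurable : forall t, measurable_fun setT (beta ^~ t) ;
  Bclass_Gamma : forall z, Gamma (beta z)
}.

Definition Bregman (beta : Z -> R -> \bar R) (g h : Z -> R) : \bar R :=
  uintegral (fun z => bregman (beta z) (g z) (h z)).

Context {n : nat}.
Variables (phi : Z -> 'rV[R]_n) (beta : Z -> R -> \bar R).
Implicit Types (theta a : 'rV[R]_n).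

Definition K theta : \bar R :=
  uintegral (fun z => econj (beta z) (dot theta (phi z))).

Definition Kconj a : \bar R :=
  ereal_sup [set (dot theta a)%:E - K theta | theta in setT].

Definition Theta : set 'rV[R]_n :=
  [set theta | K theta < +oo /\
    {ae mu, forall z, fin_near (econj (beta z)) (dot theta (phi z))}].

Definition f_ theta (z : Z) : R :=
  if `[< differentiable_at (econj (beta z)) (dot theta (phi z)) >]
  then ederiv (econj (beta z)) (dot theta (phi z)) else 0%R.

End integral_functionals.

Arguments f_ {d Z R n} phi beta theta z.

(* Main.v *)
(** Write [u z r] for the conjugate of [beta z], [f z r] for its derivative, i.e.
    the maximizer of [r * t - beta z t], and [L theta] for the dual objective
    [<theta, a> - K theta].  Concavity of [L] bounds the integral of the Jensen
    gap of [u] between two parameters by their suboptimalities; the gap at a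
    convex combination dominates the Young gaps
    [beta z s + u z r - r * s] at [s = f (combination)], hence Bregman distances
    between the associated functions.

    Along a maximizing sequence [theta_k] the integrated gaps tend to 0.  Strict
    convexity makes a small gap force closeness of the functions [f_theta] in the
    bounded coordinate [1 / (1 + s)], so a fast subsequence converges almost
    everywhere to a function [h].  For fixed [vartheta], perturb [theta_k]
    towards [vartheta] with a weight [t_k] going to 0 more slowly than the
    suboptimality of [theta_k]: the perturbed sequence has the same limit [h], and
    the gaps divided by [t_k] have integrals with upper limit at most
    [Kconj a - L vartheta].  Fatou's lemma gives the inequality for [h].

    If [h'] satisfies the inequalities too, then its Bregman distance to
    [f_(theta_k)] tends to 0 almost everywhere along a fast subsequence, which by
    strict convexity forces [h' = h]. *)
Require Import Defs.
From HB Require Import structures.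
From mathcomp Require Import all_boot all_order all_algebra.
From mathcomp Require Import all_classical all_reals all_analysis.
From mathcomp Require Import measurable_realfun.
From mathcomp Require Import ring lra.
Set Implicit Arguments.
Unset Strict Implicit.
Unset Printing Implicit Defensive.
Import Order.TTheory GRing.Theory Num.Theory.
Import numFieldNormedType.Exports.

Local Open Scope classical_set_scope.
Local Open Scope ring_scope.
Local Open Scope ereal_scope.

(** * Convex functions in the class Gamma *)

Section one_variable_convexity.
Context {R : realType} (g : R -> \bar R) (gG : Gamma g).
Implicit Types (s t x y z : R).

Let c t : R := fine (g t).

Lemma Gamma_fineK t : (0 < t)%R -> (fine (g t))%:E = g t.
Proof. by move=> t0; rewrite fineK// (Gamma_fin gG). Qed.

Lemma Gamma_fin_ge0 t : g t \is a fin_num -> (0 <= t)%R.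
Proof.
by apply: contraTT; rewrite -ltNge => t0; rewrite (Gamma_neg gG).
Qed.

Lemma Gamma_nfin_at0 t : (0 <= t)%R -> g t \isn't a fin_num ->
  t = 0%R /\ g t = +oo.
Proof.
rewrite le_eqVlt => /predU1P[<-|t0]; last by rewrite (Gamma_fin gG).
rewrite fin_numEn => /orP[/eqP g0|/eqP->//].
by have := Gamma_ltNy gG 0; rewrite g0.
Qed.

(** Strict convexity with the denominators cleared, so that later uses are polynomial
    inequalities. *)
Lemma Gamma_conv_lt x y z : (0 < x)%R -> (x < y)%R -> (y < z)%R ->
  ((z - x) * c y < (z - y) * c x + (y - x) * c z)%R.
Proof.
move=> x0 xy yz.
have y0 := lt_trans x0 xy; have z0 := lt_trans y0 yz.
have xz : (0 < z - x)%R by lra.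
pose l : R := ((z - y) / (z - x))%R.
have l1 : (1 - l = (y - x) / (z - x))%R by rewrite /l; field; lra.
have l01 : (0 < l < 1)%R.
  rewrite divr_gt0//=; last lra.
  by rewrite /l ltr_pdivrMr// mul1r; lra.
have xz' : x != z by rewrite lt_eqF//; exact: lt_trans yz.
have := Gamma_strictly_convex gG x0 z0 xz' l01.
have -> : (l * x + (1 - l) * z = y)%R by rewrite l1 /l; field; lra.
rewrite -(Gamma_fineK x0) -(Gamma_fineK y0) -(Gamma_fineK z0) -!EFinM -EFinD lte_fin.
rewrite -/(c x) -/(c y) -/(c z) l1 => h.
have : ((z - x) * c y < (z - x) * (l * c x + (y - x) / (z - x) * c z))%R.
  by rewrite ltr_pM2l.
suff -> : ((z - x) * (l * c x + (y - x) / (z - x) * c z) =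
  (z - y) * c x + (y - x) * c z)%R by [].
by rewrite /l; field; lra.
Qed.

Lemma Gamma_fine_at0 : g 0%R \is a fin_num ->
  c t @[t --> (0 : R)^'+] --> c 0%R.
Proof.
move=> g0; apply: fine_cvg; rewrite fineK//; exact: Gamma_at0 gG.
Qed.

(** The left end may be 0: continuity at 0 passes the strict inequality to the limit, where it
    becomes weak. *)
Lemma Gamma_conv x y z : g x \is a fin_num -> (x < y)%R -> (y < z)%R ->
  ((z - x) * c y <= (z - y) * c x + (y - x) * c z)%R.
Proof.
move=> gx xy yz; have := Gamma_fin_ge0 gx.
rewrite le_eqVlt => /predU1P[x0|x0]; last exact/ltW/Gamma_conv_lt.
subst x.
have h1 : ((z - t) * c y)%R @[t --> (0 : R)^'+] --> ((z - 0) * c y)%R.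
  apply: cvgMl; apply: cvgB; first exact: cvg_cst.
  exact/cvg_at_right_filter/cvg_id.
have h2 : ((z - y) * c t + (y - t) * c z)%R @[t --> (0 : R)^'+]
    --> ((z - y) * c 0 + (y - 0) * c z)%R.
  apply: cvgD; first by apply: cvgMr; exact: Gamma_fine_at0.
  apply: cvgMl; apply: cvgB; first exact: cvg_cst.
  exact/cvg_at_right_filter/cvg_id.
apply: (ler_cvg_to h1 h2); near=> t.
by apply/ltW/Gamma_conv_lt.
Unshelve. all: by end_near. Qed.

(** Chord slopes grow when both ends move right; the chord over [[x, y']] lies between the two. *)
Lemma Gamma_slope x y x' y' : g x \is a fin_num ->
  (x < y)%R -> (x' < y')%R -> (x <= x')%R -> (y <= y')%R ->
  ((c y - c x) * (y' - x') <= (c y' - c x') * (y - x))%R.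
Proof.
move=> gx xy xy' xx yy.
have gx' : g x' \is a fin_num.
  move: xx; rewrite le_eqVlt => /predU1P[<-//|xx].
  by apply: (Gamma_fin gG); apply: le_lt_trans xx; exact: Gamma_fin_ge0.
have h1 : ((c y - c x) * (y' - x) <= (c y' - c x) * (y - x))%R.
  move: yy; rewrite le_eqVlt => /predU1P[<-//|yy].
  by have := Gamma_conv gx xy yy; nra.
have h2 : ((c y' - c x) * (y' - x') <= (c y' - c x') * (y' - x))%R.
  move: xx; rewrite le_eqVlt => /predU1P[<-//|xx].
  by have := Gamma_conv gx xx xy'; nra.
have y'x : (0 < y' - x)%R by lra.
rewrite -(ler_pM2r y'x).
have a1 : (0 < y' - x')%R by lra.
have a2 : (0 < y - x)%R by lra.
have := ler_wpM2r (ltW a1) h1; have := ler_wpM2r (ltW a2) h2.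
lra.
Qed.

(** On each side of [t] the chord on the opposite side, towards [t / 2] or [t + t], extends to a
    line below [g]. *)
Lemma Gamma_cone t : (0 < t)%R -> exists2 L : R, (0 < L)%R &
  forall x, (c t - L * `|x - t|)%:E <= g x.
Proof.
move=> t0.
have h0 : (0 < t / 2)%R by lra.
pose s1 : R := ((c t - c (t / 2)) / (t / 2))%R.
pose s2 : R := ((c (t + t) - c t) / t)%R.
have s1E : (s1 * (t / 2) = c t - c (t / 2))%R by rewrite /s1; field; lra.
have s2E : (s2 * t = c (t + t) - c t)%R by rewrite /s2; field; lra.
exists (1 + `|s1| + `|s2|)%R; first by rewrite -addrA ltr_wpDr// addr_ge0.
move=> x.
have [gx|] := boolP (g x \is a fin_num); last first.
  rewrite fin_numEn => /orP[/eqP gx|/eqP->]; last exact: leey.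
  by have := Gamma_ltNy gG x; rewrite gx.
rewrite -(fineK gx) lee_fin -/(c x).
have n1 := ler_norm (- s1)%R; have n2 := ler_norm s2; rewrite normrN in n1.
have n3 := normr_ge0 s1; have n4 := normr_ge0 s2.
have [xt|tx|->] := ltgtP x t; last by rewrite subrr normr0 mulr0 subr0.
- rewrite (_ : `|x - t| = t - x)%R; last by rewrite ltr0_norm ?subr_lt0 ?opprB.
  have := @Gamma_slope x t t (t + t)%R gx xt ltac:(lra) ltac:(lra) ltac:(lra).
  have -> : (t + t - t = t)%R by lra.
  rewrite -s2E mulrAC (ler_pM2r t0) => h.
  have : (s2 * (t - x) <= (1 + `|s1| + `|s2|) * (t - x))%R.
    by rewrite ler_pM2r ?subr_gt0//; lra.
  lra.
- rewrite (_ : `|x - t| = x - t)%R; last by rewrite gtr0_norm ?subr_gt0.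
  have gh : g (t / 2)%R \is a fin_num by exact: Gamma_fin.
  have := @Gamma_slope (t / 2)%R t t x gh ltac:(lra) tx ltac:(lra) ltac:(lra).
  have -> : (t - t / 2 = t / 2)%R by lra.
  rewrite -s1E mulrAC (ler_pM2r h0) => h.
  have : (- s1 * (x - t) <= (1 + `|s1| + `|s2|) * (x - t))%R.
    by rewrite ler_pM2r ?subr_gt0//; lra.
  lra.
Qed.

Lemma Gamma_lsc t y : y%:E < g t -> \forall x \near t, y%:E < g x.
Proof.
have [t0|t0|->] := ltgtP t 0%R.
- move=> _; near=> x; rewrite (Gamma_neg gG) ?ltry//; near: x.
  exact: lt_nbhsl.
- have [L L0 cL] := Gamma_cone t0.
  rewrite -(Gamma_fineK t0) lte_fin -/(c t) => yt.
  have e0 : (0 < (c t - y) / L)%R by rewrite divr_gt0// subr_gt0.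
  near=> x; apply: lt_le_trans (cL x); rewrite lte_fin.
  have : (`|x - t| < (c t - y) / L)%R.
    rewrite distrC; near: x; exact: cvgr_dist_lt.
  rewrite ltr_pdivlMr//; lra.
- move=> y0.
  have := Gamma_at0 gG => /(_ [set u | y%:E < u]) /=.
  move=> /(_ (open_nbhs_nbhs _)) h.
  have {h} : \forall x \near (0 : R)^'+, y%:E < g x.
    by apply: h; split => //; exact: open_ereal_gt_ereal.
  rewrite /at_right near_withinE => h.
  near=> x; have [x0|x0|->//] := ltgtP x 0%R.
    by rewrite (Gamma_neg gG) ?ltry.
  by move: x0; near: x.
Unshelve. all: by end_near. Qed.

Lemma Gamma_lsc_cvg (u : nat -> R) t (e : nat -> R) l :
  u @ \oo --> t -> e @ \oo --> l -> (forall k, g (u k) <= (e k)%:E) ->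
  g t <= l%:E.
Proof.
move=> ut el gu; apply/lee_addgt0Pr => d d0.
rewrite -EFinD leNgt; apply/negP => /Gamma_lsc h.
have : \forall k \near \oo, (e k < l + d)%R.
  by apply: (cvgr_lt l el); rewrite ltrDl.
have : \forall k \near \oo, (l + d)%:E < g (u k) by move/ut: h.
near_simpl => h1 h2.
have [k [k1 k2]] : exists k, (l + d)%:E < g (u k) /\ (e k < l + d)%R.
  exact: (@filter_ex _ \oo _ _ (filterI h1 h2)).
by have := lt_le_trans k1 (gu k); rewrite lte_fin => /(lt_trans k2); rewrite ltxx.
Unshelve. all: by end_near. Qed.

(** The ends are moved one at a time. The midpoint moves half as far as the end, and [Gamma_slope]
    compares the two increments. *)
Lemma Gamma_defect_mono s t a b : g s \is a fin_num ->
  (s <= a)%R -> (a < b)%R -> (b <= t)%R ->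
  (c a + c b - 2 * c ((a + b) / 2) <= c s + c t - 2 * c ((s + t) / 2))%R.
Proof.
move=> gs sa ab bt.
have h1 : (c s + c b - 2 * c ((s + b) / 2) <= c s + c t - 2 * c ((s + t) / 2))%R.
  move: bt; rewrite le_eqVlt => /predU1P[->//|bt].
  have gm : g ((s + b) / 2)%R \is a fin_num.
    apply: (Gamma_fin gG); have := Gamma_fin_ge0 gs; lra.
  have := @Gamma_slope _ ((s + t) / 2)%R b t gm
    ltac:(lra) ltac:(lra) ltac:(lra) ltac:(lra).
  have -> : ((s + t) / 2 - (s + b) / 2 = (t - b) / 2)%R by lra.
  have tb : (0 < t - b)%R by lra.
  by rewrite mulrA (mulrAC _ (t - b)%R) (ler_pM2r tb); lra.
apply: le_trans h1.
move: sa; rewrite le_eqVlt => /predU1P[->//|sa].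
have := @Gamma_slope s a ((s + b) / 2)%R ((a + b) / 2)%R gs
    ltac:(lra) ltac:(lra) ltac:(lra) ltac:(lra).
have -> : ((a + b) / 2 - (s + b) / 2 = (a - s) / 2)%R by lra.
have tb : (0 < a - s)%R by lra.
by rewrite mulrA (mulrAC _ (a - s)%R) (ler_pM2r tb); lra.
Qed.

Lemma Gamma_defect_gt0 a b : (0 < a)%R -> (a < b)%R ->
  (0 < c a + c b - 2 * c ((a + b) / 2))%R.
Proof.
move=> a0 ab.
have := @Gamma_conv_lt a ((a + b) / 2)%R b a0 ltac:(lra) ltac:(lra).
have -> : (b - (a + b) / 2 = (b - a) / 2)%R by lra.
have -> : ((a + b) / 2 - a = (b - a) / 2)%R by lra.
have tb : (0 < b - a)%R by lra.
by move=> h; rewrite -(ltr_pM2l tb) mulr0; lra.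
Qed.

End one_variable_convexity.

(** * A bounded coordinate on the half-line *)

Section reciprocal_coordinate.
Context {R : realType}.
Implicit Types s t : R.

(* Bounded coordinate on [0, +oo[ in which escape to infinity is convergence
   to 0. *)
Definition recip s : R := ((1 + `|s|)^-1)%R.

Lemma recip_gt0 s : (0 < recip s)%R.
Proof. by rewrite invr_gt0 ltr_pwDl. Qed.

Lemma recip_le1 s : (recip s <= 1)%R.
Proof. by rewrite invf_le1 ?lerDl ?ltr_pwDl. Qed.

Lemma recip_dist_le1 s t : (`|recip s - recip t| <= 1)%R.
Proof.
have := recip_gt0 s; have := recip_gt0 t.
have := recip_le1 s; have := recip_le1 t.
by rewrite ler_norml; lra.
Qed.

Lemma recipK s : (0 <= s)%R -> ((recip s)^-1 - 1 = s)%R.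
Proof. by move=> s0; rewrite /recip invrK ger0_norm// addrAC subrr add0r. Qed.

Lemma recip_distE s t : (0 <= s)%R -> (0 <= t)%R ->
  (`|s - t| = `|recip s - recip t| * ((1 + s) * (1 + t)))%R.
Proof.
move=> s0 t0; rewrite /recip (ger0_norm s0) (ger0_norm t0).
have p : (0 <= (1 + s) * (1 + t))%R by apply: mulr_ge0; lra.
by rewrite -[in RHS](ger0_norm p) -normrM distrC; congr (`|_|)%R; field; lra.
Qed.

Lemma recip_cvg_pos (u : nat -> R) (l : R) : (forall k, (0 <= u k)%R) ->
  l != 0%R -> recip (u k) @[k --> \oo] --> l -> u @ \oo --> (l^-1 - 1)%R.
Proof.
move=> u0 l0 ul.
rewrite (_ : u = fun k => ((recip (u k))^-1 - 1)%R); last first.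
  by apply/funext => k; rewrite recipK.
by apply: cvgB; [exact: cvgV | exact: cvg_cst].
Qed.

End reciprocal_coordinate.

(** * Midpoint defect, and existence of maximizers in the conjugate *)

Section defect.
Context {R : realType} (g : R -> \bar R) (gG : Gamma g).
Implicit Types (r s t : R).

(* A small midpoint defect forces closeness in the coordinate [recip]: an
   interval [s, t] on which [recip] varies by [eta] contains one of finitely
   many grid cells, whose defects are positive. *)
Lemma defect_recip (eta : R) : (0 < eta)%R -> exists2 delta : R, (0 < delta)%R &
  forall s t, (0 <= s)%R -> (0 <= t)%R ->
    g s + g t <= 2%:E * g ((s + t) / 2)%R + delta%:E ->
    (`|recip s - recip t| < eta)%R.
Proof.
move=> eta0; pose h : R := (eta / 2)%R.
have h0 : (0 < h)%R by rewrite /h; lra.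
have etaE : (eta = 2 * h)%R by rewrite /h; lra.
clearbody h.
pose M (a b : R) := (fine (g a) + fine (g b) - 2 * fine (g ((a + b) / 2)))%R.
(* Only [s <= eta^-1] will occur, which bounds the number of cells of width [h]. Indices start at
   [j.+1] to keep the cells inside the open half-line, where convexity is strict. *)
pose N := (Num.truncn (eta^-1 / h)).+1.
pose m : R := \big[Order.min/1%R]_(j < N) M (j.+1%:R * h)%R (j.+2%:R * h)%R.
have jh (j : nat) : (j.+1%:R * h < j.+2%:R * h)%R.
  by rewrite ltr_pM2r// ltr_nat.
have m0 : (0 < m)%R.
  apply: lt_bigmin => // j _; apply: Gamma_defect_gt0 => //.
  by rewrite mulr_gt0.
exists (m / 2)%R; first lra.
suff H s t : (0 <= s)%R -> (s < t)%R ->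
    g s + g t <= 2%:E * g ((s + t) / 2)%R + (m / 2)%:E ->
    (`|recip s - recip t| < eta)%R.
  move=> s t s0 t0; have [st|ts|<-] := ltgtP s t; first exact: H.
  - by rewrite addeC [in X in X -> _](addrC s) distrC; exact: H.
  - by rewrite subrr normr0.
move=> s0 st; have t0 : (0 < t)%R := le_lt_trans s0 st.
have mid0 : (0 < (s + t) / 2)%R by lra.
rewrite -(Gamma_fineK gG t0) -(Gamma_fineK gG mid0) -EFinM -EFinD.
have [gs|/(Gamma_nfin_at0 gG s0)[_ ->//]] := boolP (g s \is a fin_num).
rewrite -(fineK gs) -EFinD lee_fin => Mle.
rewrite ltNge; apply/negP => qst.
(* If the coordinates differ by at least [eta], then [t - s] is at least [eta] and [s] is at most
   [eta^-1]. *)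
have dst : (eta * ((1 + s) * (1 + t)) <= t - s)%R.
  have := recip_distE s0 (ltW t0); rewrite distrC gtr0_norm ?subr_gt0// => ->.
  by rewrite ler_wpM2r// mulr_ge0//; lra.
have ts : (eta <= t - s)%R.
  by apply: le_trans dst; rewrite ler_peMr ?(ltW eta0)//; nra.
have seta : (s <= eta^-1)%R.
  rewrite -(ler_pM2r eta0) mulVf ?gt_eqF//.
  have : (eta * (1 + s) * (1 + t) <= 1 * (1 + t))%R by lra.
  have t1 : (0 < 1 + t)%R by lra.
  by rewrite (ler_pM2r t1); lra.
(* The cell starts at the first grid point after [s] and ends at
   [j.+2 * h <= s + 2 * h = s + eta <= t]. *)
pose j := Num.truncn (s / h).
have sh0 : (0 <= s / h)%R by rewrite divr_ge0// ltW.
have jN : (j < N)%N.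
  by rewrite ltnS; apply: le_truncn; rewrite ler_pM2r// invr_gt0.
have /andP[j1 j2] := truncn_itv sh0.
rewrite ler_pdivlMr// in j1; rewrite ltr_pdivrMr// in j2.
rewrite -/j in j1 j2.
have : (m <= M (j.+1%:R * h) (j.+2%:R * h))%R.
  exact: (bigmin_le _ (Ordinal jN)).
have : (M (j.+1%:R * h) (j.+2%:R * h) <= M s t)%R.
  apply: Gamma_defect_mono => //; first exact: ltW.
  have -> : (j.+2%:R = j%:R + 2 :> R)%R by rewrite -natrD addn2.
  by rewrite mulrDl; lra.
by rewrite /M; lra.
Qed.

Lemma econj_Young r s : (r * s)%:E - g s <= econj g r.
Proof. by apply: ereal_sup_ubound; exists s. Qed.

Lemma econj_gtNy r : -oo < econj g r.
Proof.
apply: lt_le_trans (econj_Young r 1%R).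
by rewrite -(Gamma_fineK gG (@ltr01 R)) -EFinB ltNyr.
Qed.

Lemma econj_fin r : econj g r < +oo -> econj g r \is a fin_num.
Proof. by move=> u; rewrite fin_numElt econj_gtNy. Qed.

(** Since [g] is [+oo] on the negative axis, only slopes [s >= 0] count in the supremum. *)
Lemma econj_le r r' : (r <= r')%R -> econj g r <= econj g r'.
Proof.
move=> rr; apply: ge_ereal_sup => _ [s _ <-].
apply: le_trans (econj_Young r' s).
have [s0|s0] := ltP s 0%R; first by rewrite (Gamma_neg gG)// leNye.
by apply: leeB => //; rewrite lee_fin ler_wpM2r.
Qed.

Lemma Young_real r s : econj g r \is a fin_num -> g s \is a fin_num ->
  (r * s - fine (g s) <= fine (econj g r))%R.
Proof.
move=> u gs; rewrite -lee_fin (fineK u) EFinB (fineK gs); exact: econj_Young.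
Qed.

Lemma econj_convex (l : R) r r' : (0 <= l <= 1)%R ->
  econj g r \is a fin_num -> econj g r' \is a fin_num ->
  econj g ((1 - l) * r + l * r')%R <=
    ((1 - l) * fine (econj g r) + l * fine (econj g r'))%:E.
Proof.
move=> /andP[l0 l1] u u'; apply: ge_ereal_sup => _ [s _ <-].
have [gs|] := boolP (g s \is a fin_num); last first.
  rewrite fin_numEn => /orP[/eqP gs|/eqP->]; last by rewrite leNye.
  by have := Gamma_ltNy gG s; rewrite gs.
rewrite -(fineK gs) -EFinB lee_fin.
have := Young_real u gs; have := Young_real u' gs.
have l1' : (0 <= 1 - l)%R by lra.
by move=> /(ler_wpM2l l0) + /(ler_wpM2l l1'); lra.
Qed.

(** By monotonicity, one finite value strictly to the right bounds the conjugate near [r]; it is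
    never [-oo]. *)
Lemma fin_nearP r :
  fin_near (econj g) r <-> exists2 e : R, (0 < e)%R & econj g (r + e)%R < +oo.
Proof.
split=> [|[e e0 ue]].
  move=> /nbhs_ballP[e /= e0 H]; exists (e / 2)%R; first by lra.
  have : econj g (r + e / 2)%R \is a fin_num.
    by apply: H; rewrite /ball/= opprD addrA subrr sub0r normrN gtr0_norm;
      move: e0 => /=; lra.
  by rewrite fin_numElt => /andP[].
rewrite /fin_near; near=> s; apply: econj_fin; apply: le_lt_trans ue.
apply: econj_le; apply: ltW; near: s; apply: lt_nbhsl; lra.
Unshelve. all: by end_near. Qed.

Lemma fin_near_fin r : fin_near (econj g) r -> econj g r \is a fin_num.
Proof. exact: nbhs_singleton. Qed.

(** The equality case of Young's inequality, whose other half always holds. Finiteness is included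
    because [fine] sends infinite values to 0. *)
Definition is_argmax r t : Prop := econj g r \is a fin_num /\
  g t <= (r * t - fine (econj g r))%:E.

Lemma gap_fin t (x : R) : g t <= x%:E -> g t \is a fin_num.
Proof.
by move=> gt; rewrite fin_numElt (Gamma_ltNy gG)/= (le_lt_trans gt)// ltry.
Qed.

Lemma argmax_fin r t : is_argmax r t -> g t \is a fin_num.
Proof. by move=> [_ /gap_fin]. Qed.

Lemma argmax_ge0 r t : is_argmax r t -> (0 <= t)%R.
Proof. by move=> /argmax_fin /(Gamma_fin_ge0 gG). Qed.

Lemma argmax_fine r t : is_argmax r t ->
  (fine (g t) = r * t - fine (econj g r))%R.
Proof.
move=> a; have gt := argmax_fin a; case: a => u.
rewrite -(fineK gt) lee_fin => h.
by have := Young_real u gt; lra.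
Qed.

(** Add the two bounds and apply Young's inequality at the midpoint: the linear terms cancel. *)
Lemma gap_defect r s t (e1 e2 : R) : econj g r \is a fin_num ->
  g s <= (r * s - fine (econj g r) + e1)%:E ->
  g t <= (r * t - fine (econj g r) + e2)%:E ->
  g s + g t <= 2%:E * g ((s + t) / 2)%R + (e1 + e2)%:E.
Proof.
move=> u hs ht.
have gs := gap_fin hs; have gt := gap_fin ht.
have s0 := Gamma_fin_ge0 gG gs; have t0 := Gamma_fin_ge0 gG gt.
move: hs ht; rewrite -(fineK gs) -(fineK gt) !lee_fin => hs ht.
have st0 : (0 <= (s + t) / 2)%R by lra.
have [gm|/(Gamma_nfin_at0 gG st0)[_ ->]] :=
  boolP (g ((s + t) / 2)%R \is a fin_num).
  rewrite -(fineK gm) -EFinM -!EFinD lee_fin.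
  by have := Young_real u gm; lra.
by rewrite gt0_muley ?lte_fin// addye// leey.
Qed.

(** A maximizing sequence is bounded because the conjugate is finite at some [r + e], Cauchy because
    midpoint defects tend to 0, and its limit is a maximizer by lower semicontinuity. *)
Lemma argmax_exists r : fin_near (econj g) r -> exists t, is_argmax r t.
Proof.
move=> ur; have u := fin_near_fin ur.
have /fin_nearP[e e0 /econj_fin v] := ur.
have H k : exists t, g t <= (r * t - fine (econj g r) + k.+1%:R^-1)%:E.
  have : (fine (econj g r) - k.+1%:R^-1)%:E < econj g r.
    by rewrite -[ltRHS](fineK u) lte_fin ltrBlDr ltrDl invr_gt0 ltr0n.
  move=> /ereal_sup_gt[_ [t _ <-]] ht; exists t.
  move: ht; case: (g t) (Gamma_ltNy gG t) => // x _.
  by rewrite -EFinB lte_fin lee_fin; set a := (_^-1)%R; lra.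
have [t ht] := choice H.
have gt k : g (t k) \is a fin_num := gap_fin (ht k).
have t0 k : (0 <= t k)%R := Gamma_fin_ge0 gG (gt k).
have k1 k : (k.+1%:R^-1 <= 1 :> R)%R by rewrite invf_le1 ?ler1n ?ltr0n.
pose B : R := ((fine (econj g (r + e)) - fine (econj g r) + 1) / e)%R.
have tB k : (t k <= B)%R.
  rewrite /B ler_pdivlMr//.
  have := ht k; rewrite -(fineK (gt k)) lee_fin.
  by have := Young_real v (gt k); have := k1 k; set a := (k.+1%:R^-1)%R; lra.
have B0 : (0 <= B)%R := le_trans (t0 0%N) (tB 0%N).
have tC : cvgn t.
  apply: cauchy_cvg; apply: cauchy_exP => eps /= eps0.
  (* On [[0, B]] the usual distance is at most this factor times the distance of the coordinates
     [recip]. *)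
  have C0 : (0 < (1 + B) * (1 + B))%R by nra.
  have [d d0 H2] := defect_recip (divr_gt0 eps0 C0).
  pose n := Num.truncn (2 / d)%R.
  exists (t n); exists n => // k /= nk.
  have inv m : (n <= m)%N -> (m.+1%:R^-1 <= d / 2 :> R)%R.
    move=> nm; rewrite -[leRHS]invrK lef_pV2 ?posrE ?invr_gt0 ?divr_gt0//.
    rewrite invf_div (le_trans (ltW (truncnS_gt _)))// ler_nat ltnS.
    exact: nm.
  have := H2 _ _ (t0 n) (t0 k).
  have /[swap]/[apply] : g (t n) + g (t k) <= 2%:E * g ((t n + t k) / 2)%R + d%:E.
    apply: le_trans (gap_defect u (ht n) (ht k)) _.
    apply: leeD => //; rewrite lee_fin.
    by have := inv n (leqnn n); have := inv k nk; set x := (_^-1)%R;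
      set y := (n.+1%:R^-1)%R; lra.
  rewrite ltr_pdivlMr// => q.
  rewrite /ball/= (recip_distE (t0 n) (t0 k)); apply: le_lt_trans q.
  rewrite ler_wpM2l// ler_pM ?lerD2l ?tB//; have := t0 n; have := t0 k; lra.
exists (limn t); split => //.
apply: (Gamma_lsc_cvg gG tC
  (e := fun k => r * t k - fine (econj g r) + k.+1%:R^-1)%R) => //.
rewrite -[X in _ --> X]addr0; apply: cvgD; last exact: cvg_harmonic.
by apply: cvgB; [exact: cvgMr | exact: cvg_cst].
Qed.

(** The difference quotient with step [h] lies between [t] and the maximizer [s] at [r + h]. The
    midpoint defect of [s] and [t] is at most [|h| * |s - t|], so [s] tends to [t]. *)
Lemma econj_deriv r t : fin_near (econj g) r -> is_argmax r t ->
  is_derive r (1%R : R) (fine \o econj g) t.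
Proof.
move=> ur a; have t0 := argmax_ge0 a; have u := fin_near_fin ur.
have gt := argmax_fin a; have gtE := argmax_fine a.
have /fin_nearP[e e0 ve] := ur; have v := econj_fin ve.
(* A bound for all maximizers at [r + h] with [|h| < e / 2]: such points stay at distance at least
   [e / 2] from [r + e]. *)
pose B : R := ((fine (econj g (r + e)) - fine (econj g r) + e * t) / (e / 2))%R.
have fn h : (`|h| < e / 2)%R -> fin_near (econj g) (r + h)%R.
  move=> he; apply/fin_nearP; exists (e / 2)%R; first lra.
  apply: le_lt_trans ve; apply: econj_le.
  by have := ler_norm h; lra.
have key h s : (`|h| < e / 2)%R -> is_argmax (r + h)%R s ->
    [/\ (0 <= s)%R, (s <= B)%R,
      (h * t <= fine (econj g (r + h)) - fine (econj g r) <= h * s)%R &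
      g s + g t <= 2%:E * g ((s + t) / 2)%R + (`|h| * `|s - t|)%:E].
  move=> he b; have s0 := argmax_ge0 b; have gs := argmax_fin b.
  have gsE := argmax_fine b; have w : econj g (r + h)%R \is a fin_num by case: b.
  have y1 := Young_real v gs; have y2 := Young_real u gs.
  have y3 := Young_real w gt.
  move: he; rewrite ltr_norml => /andP[he1 he2].
  split => //.
  - by rewrite /B ler_pdivlMr; nra.
  - by apply/andP; split; lra.
  - have := @gap_defect r s t (h * (s - t))%R 0%R u; rewrite !addr0 => H.
    apply: le_trans (H _ _) _.
    + by rewrite -(fineK gs) lee_fin; lra.
    + by rewrite -(fineK gt) lee_fin; lra.
    + by apply: leeD => //; rewrite lee_fin -normrM ler_norm.
have B0 : (0 <= B)%R.
  have h0 : (`|0%R : R| < e / 2)%R by rewrite normr0; lra.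
  have [s b] := argmax_exists (fn _ h0); have [s0 sB _ _] := key _ _ h0 b.
  exact: le_trans sB.
suff H : (h^-1 *: ((fine \o econj g) (h *: (1%R : R) + r) - (fine \o econj g) r))%R
    @[h --> (0%R : R)^'] --> t.
  by apply: DeriveDef; [apply/cvg_ex; exists t | exact: cvg_lim].
apply/cvgrPdist_lt => eps eps0.
have C0 : (0 < (1 + B) * (1 + t))%R by nra.
have [d d0 H2] := defect_recip (divr_gt0 eps0 C0).
have Bt0 : (0 < B + t + 1)%R by lra.
near=> h.
have h0 : h != 0%R by near: h; exact: nbhs_dnbhs_neq.
have he : (`|h| < e / 2)%R.
  by near: h; apply: dnbhs0_lt; lra.
have hd : (`|h| < d / (B + t + 1))%R.
  by near: h; apply: dnbhs0_lt; rewrite divr_gt0.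
have [s b] := argmax_exists (fn _ he).
have [s0 sB /andP[q1 q2] Mst] := key _ _ he b.
have stB : (`|s - t| <= B + t)%R by rewrite ler_norml; lra.
have : (`|recip s - recip t| < eps / ((1 + B) * (1 + t)))%R.
  apply: H2 => //; apply: le_trans Mst _; apply: leeD => //; rewrite lee_fin.
  move: hd; rewrite ltr_pdivlMr// => hd; apply: le_trans (ltW hd).
  by rewrite ler_wpM2l//; lra.
rewrite ltr_pdivlMr// => q.
have : (`|s - t| < eps)%R.
  rewrite (recip_distE s0 t0); apply: le_lt_trans q.
  by rewrite ler_wpM2l// ler_pM2r; lra.
apply: le_lt_trans.
rewrite /= [(h *: _)%R]mulr1 [(h + r)%R]addrC.
rewrite (_ : (t - _)%R =
    (h^-1 * (h * t - (fine (econj g (r + h)) - fine (econj g r))))%R); last first.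
  by rewrite mulrBr mulKf.
have hh : (0 < `|h|)%R by rewrite normr_gt0.
rewrite normrM normfV ler_pdivrMl// -normrM.
rewrite ler0_norm; last lra.
by rewrite ger0_norm; lra.
Unshelve. all: by end_near. Qed.

End defect.

(** * Bregman distance at a maximizer *)

Section argmax_consequences.
Context {R : realType} (g : R -> \bar R) (gG : Gamma g).
Implicit Types (r s t u : R).

Lemma econj_ederiv r : fin_near (econj g) r ->
  differentiable_at (econj g) r /\ is_argmax g r (ederiv (econj g) r).
Proof.
move=> ur; have [t a] := argmax_exists gG ur.
have d := econj_deriv gG ur a.
split; first by split => //; exact: ex_derive.
by rewrite /ederiv derive1E derive_val.
Qed.

(** A countable family of steps, so that the derivative is measurable in a parameter. *)
Lemma econj_quot_cvg r : fin_near (econj g) r ->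
  (econj g (r + k.+1%:R^-1)%R - econj g r) * (k.+1%:R)%:E @[k --> \oo]
    --> (ederiv (econj g) r)%:E.
Proof.
move=> ur; have [[_ d] a] := econj_ederiv ur.
have u := fin_near_fin ur.
have k0 : (k.+1%:R^-1)%R @[k --> \oo] --> (0%R : R) := cvg_harmonic.
have rk : (r + k.+1%:R^-1)%R @[k --> \oo] --> r.
  by rewrite -[X in _ --> X]addr0; apply: cvgD => //; exact: cvg_cst.
apply/fine_cvgP; split.
  have : \forall k \near \oo, econj g (r + k.+1%:R^-1)%R \is a fin_num.
    exact: (rk _ ur).
  apply: filterS => k uk; rewrite fin_numM// fin_numB uk u//.
have q : (h^-1 *: ((fine \o econj g) (h *: (1%R : R) + r) - (fine \o econj g) r))%R
    @[h --> (0%R : R)^'] --> ederiv (econj g) r.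
  by rewrite /ederiv derive1E; exact: d.
have k0' (k : nat) : (k.+1%:R^-1)%R != 0%R :> R by rewrite invr_neq0.
move/cvgr_dnbhsP : q => /(_ (fun k => k.+1%:R^-1)%R (conj k0' k0)) q.
apply: cvg_trans q; apply: near_eq_cvg.
have : \forall k \near \oo, econj g (r + k.+1%:R^-1)%R \is a fin_num.
  exact: (rk _ ur).
apply: filterS => k uk.
rewrite invrK [(_ *: 1)%R]mulr1 (addrC _ r) /= fineM ?fin_numB ?uk ?u// fineB//.
by rewrite mulrC.
Qed.

(** For [e > 0] this bounds [s] in terms of its Young gap [x] at [r]. *)
Lemma coercive r s (e x : R) : econj g r \is a fin_num ->
  econj g (r + e)%R \is a fin_num ->
  g s <= (r * s - fine (econj g r) + x)%:E ->
  (e * s <= fine (econj g (r + e)) - fine (econj g r) + x)%R.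
Proof.
move=> u v gs; have s_fin := gap_fin gG gs.
move: gs; rewrite -(fineK s_fin) lee_fin => gs.
by have := Young_real v s_fin; lra.
Qed.

(* At the maximizer [s] of [w * s - g s], the Jensen gap is the convex
   combination of the two Young gaps of [s] at [r] and [r']. *)
Lemma jensen_gap_Young r r' s (l w : R) : (0 <= l <= 1)%R ->
  w = ((1 - l) * r + l * r')%R ->
  econj g r \is a fin_num -> econj g r' \is a fin_num -> is_argmax g w s ->
  let gap := ((1 - l) * fine (econj g r) + l * fine (econj g r')
    - fine (econj g w))%R in
  ((0 < l)%R -> g s <= (r' * s - fine (econj g r') + gap / l)%:E) /\
  ((l < 1)%R -> g s <= (r * s - fine (econj g r) + gap / (1 - l))%:E).
Proof.
move=> /andP[l0 l1] wE u u' a gap.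
have gs := argmax_fin gG a; have gsE := argmax_fine gG a.
have y1 := Young_real u gs; have y2 := Young_real u' gs.
have gapE : gap = ((1 - l) * (fine (g s) - r * s + fine (econj g r)) +
    l * (fine (g s) - r' * s + fine (econj g r')))%R.
  by rewrite /gap gsE wE; ring.
have p1 : (0 <= (1 - l) * (fine (g s) - r * s + fine (econj g r)))%R.
  by apply: mulr_ge0; lra.
have p2 : (0 <= l * (fine (g s) - r' * s + fine (econj g r')))%R.
  by apply: mulr_ge0; lra.
rewrite -(fineK gs) !lee_fin; split => l'.
- have : (fine (g s) - r' * s + fine (econj g r') <= gap / l)%R.
    by rewrite ler_pdivlMr//; lra.
  lra.
- have : (fine (g s) - r * s + fine (econj g r) <= gap / (1 - l))%R.
    by rewrite ler_pdivlMr ?subr_gt0//; lra.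
  lra.
Qed.

Let c t : R := fine (g t).

Lemma right_deriv_gt0 t : (0 < t)%R -> exists D : R,
  [/\ lim (diff_quot g t e @[e --> (0%R : R)^'+]) = D%:E,
    (forall u, (t < u)%R -> (D * (u - t) <= c u - c t)%R) &
    (forall y, (forall u, (t < u)%R -> (y * (u - t) <= c u - c t)%R) -> (y <= D)%R)].
Proof.
move=> t0; have tf := Gamma_fin gG t0.
have dE e : (0 < e)%R -> diff_quot g t e = ((c (t + e) - c t) / e)%:E.
  move=> e0; have te0 : (0 < t + e)%R by lra.
  by rewrite /diff_quot -(Gamma_fineK gG te0) -(Gamma_fineK gG t0) -EFinB -EFinM.
have mono : {in Interval (BRight (0%R : R)) +oo%O &,
    nondecreasing_fun (diff_quot g t)}.
  move=> e e'; rewrite !in_itv/= !andbT => e0 e'0 ee.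
  rewrite !dE// lee_fin ler_pdivlMr// mulrAC ler_pdivrMr//.
  have := @Gamma_slope _ g gG t (t + e)%R t (t + e')%R tf
    ltac:(lra) ltac:(lra) ltac:(lra) ltac:(lra).
  by rewrite !(addrC t) !addrK.
have /cvg_lim -> // := nondecreasing_at_right_cvge +oo%O isT mono.
set S := _ @` _.
have t2 : (0 < t / 2)%R by lra.
have t2f := Gamma_fin gG t2.
have lb : ((c t - c (t / 2)) / (t / 2))%:E <= ereal_inf S.
  apply: le_ereal_inf_tmp => _ [e /= + <-]; rewrite in_itv/= andbT => e0.
  rewrite dE// lee_fin ler_pdivrMr// mulrAC ler_pdivlMr//.
  have := @Gamma_slope _ g gG (t / 2)%R t t (t + e)%R t2f
    ltac:(lra) ltac:(lra) ltac:(lra) ltac:(lra).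
  by rewrite addrAC subrr add0r (_ : t - t / 2 = t / 2)%R//; lra.
have ub e : (0 < e)%R -> ereal_inf S <= ((c (t + e) - c t) / e)%:E.
  move=> e0; rewrite -dE//; apply: ereal_inf_lbound; exists e => //=.
  by rewrite in_itv/= e0.
have Sfin : ereal_inf S \is a fin_num.
  rewrite fin_numElt (lt_le_trans _ lb) ?ltNyr//=.
  by rewrite (le_lt_trans (ub _ ltr01))// ltry.
exists (fine (ereal_inf S)); split; first by rewrite fineK.
- move=> u tu; have ut : (0 < u - t)%R by lra.
  have := ub _ ut; rewrite -(fineK Sfin) lee_fin ler_pdivlMr//.
  by rewrite [(t + _)%R]addrC subrK.
- move=> y H; rewrite -lee_fin fineK//.
  apply: le_ereal_inf_tmp => _ [e /= + <-]; rewrite in_itv/= andbT => e0.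
  rewrite dE// lee_fin ler_pdivlMr//.
  have := H (t + e)%R ltac:(lra).
  by rewrite (addrC t e) addrK.
Qed.

Lemma left_deriv_gt0 t : (0 < t)%R -> exists D : R,
  [/\ lim (diff_quot g t e @[e --> (0%R : R)^'-]) = D%:E,
    (forall u, (u < t)%R -> g u \is a fin_num -> (c t - c u <= D * (t - u))%R) &
    (forall y, (forall u, (u < t)%R -> g u \is a fin_num ->
      (c t - c u <= y * (t - u))%R) -> (D <= y)%R)].
Proof.
move=> t0; have tf := Gamma_fin gG t0.
(* Reversing the sign of the step turns the left limit into a right limit of a nonincreasing
   function. *)
pose q e := diff_quot g t (- e)%R.
have qE e : (0 < e)%R -> g (t - e)%R \is a fin_num ->
    q e = ((c t - c (t - e)) / e)%:E.
  move=> e0 gte; rewrite /q /diff_quot -(fineK gte) -(fineK tf) -EFinB -EFinM.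
  by congr (_%:E); rewrite -/(c t) -/(c (t - e)) invrN; lra.
have mono : {in Interval (BRight (0%R : R)) (BLeft t) &, nonincreasing_fun q}.
  move=> e e'; rewrite !in_itv/= => /andP[e0 et] /andP[e'0 e't] ee.
  have f1 : g (t - e)%R \is a fin_num by apply: (Gamma_fin gG); lra.
  have f2 : g (t - e')%R \is a fin_num by apply: (Gamma_fin gG); lra.
  rewrite !qE// lee_fin ler_pdivlMr// mulrAC ler_pdivrMr//.
  have := @Gamma_slope _ g gG (t - e')%R t (t - e)%R t f2
    ltac:(lra) ltac:(lra) ltac:(lra) ltac:(lra).
  by rewrite !subKr.
have inf := nonincreasing_at_right_cvge (BLeft t) t0 mono.
have {inf} /cvg_lim -> // : diff_quot g t e @[e --> (0%R : R)^'-] -->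
   ereal_sup [set q x | x in [set` Interval (BRight (0%R : R)) (BLeft t)]].
  by apply/cvg_at_leftNP; rewrite oppr0.
set S := _ @` _.
have lb u : (u < t)%R -> g u \is a fin_num ->
    ((c t - c u) / (t - u))%:E <= ereal_sup S.
  move=> ut gu; have u0 := Gamma_fin_ge0 gG gu.
  apply: (@le_trans _ _ (q ((t - u) / 2)%R)); last first.
    by apply: ereal_sup_ubound; exists ((t - u) / 2)%R => //=; rewrite in_itv/=; lra.
  have f1 : g (t - (t - u) / 2)%R \is a fin_num by apply: (Gamma_fin gG); lra.
  rewrite qE//; last lra.
  rewrite lee_fin ler_pdivrMr ?subr_gt0// mulrAC ler_pdivlMr; last lra.
  have := @Gamma_slope _ g gG u t (t - (t - u) / 2)%R t gu
    ltac:(lra) ltac:(lra) ltac:(lra) ltac:(lra).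
  by rewrite (_ : t - (t - (t - u) / 2) = (t - u) / 2)%R//; lra.
have ub : ereal_sup S <= (c (t + 1) - c t)%:E.
  apply: ge_ereal_sup => _ [e /= + <-]; rewrite in_itv/= => /andP[e0 et].
  have f1 : g (t - e)%R \is a fin_num by apply: (Gamma_fin gG); lra.
  rewrite qE// lee_fin ler_pdivrMr//.
  have := @Gamma_slope _ g gG (t - e)%R t t (t + 1)%R f1
    ltac:(lra) ltac:(lra) ltac:(lra) ltac:(lra).
  by rewrite addrAC subrr add0r subKr mulr1.
have t2 : (0 < t / 2)%R by lra.
have t2f := Gamma_fin gG t2.
have Sfin : ereal_sup S \is a fin_num.
  rewrite fin_numElt (le_lt_trans ub) ?ltry// andbT.
  by apply: lt_le_trans (lb (t / 2)%R _ t2f); rewrite ?ltNyr//; lra.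
exists (fine (ereal_sup S)); split; first by rewrite fineK.
- move=> u ut gu.
  by have := lb _ ut gu; rewrite -(fineK Sfin) lee_fin ler_pdivrMr ?subr_gt0.
- move=> y H; rewrite -lee_fin fineK//.
  apply: ge_ereal_sup => _ [e /= + <-]; rewrite in_itv/= => /andP[e0 et].
  have f1 : g (t - e)%R \is a fin_num by apply: (Gamma_fin gG); lra.
  rewrite qE// lee_fin ler_pdivrMr//.
  have := H (t - e)%R ltac:(lra) f1.
  by rewrite subKr.
Qed.

(** The slope [r] supports [g] at [t] and bounds the right derivative below, even at [t = 0]. Hence
    the infinite branch of [bregman] does not occur at a maximizer. *)
Lemma right_deriv_argmax r t : is_argmax g r t -> exists D : R,
  [/\ right_deriv g t = D%:E, (r <= D)%R &
    forall u, (t < u)%R -> (D * (u - t) <= c u - c t)%R].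
Proof.
move=> a; have t0 := argmax_ge0 gG a; have tf := argmax_fin gG a.
have tE := argmax_fine gG a; have ur : econj g r \is a fin_num by case: a.
have ra v : (0 < v)%R -> (r * (v - t) <= c v - c t)%R.
  move=> v0; have := Young_real ur (Gamma_fin gG v0).
  by rewrite /c tE; lra.
move: t0; rewrite le_eqVlt => /predU1P[t0|t0]; last first.
  have [D [DE D1 D2]] := right_deriv_gt0 t0.
  exists D; split=> //; first by rewrite /right_deriv gt_eqF.
  by apply: D2 => u tu; apply: ra; exact: lt_trans tu.
subst t; rewrite /right_deriv eqxx.
have /choice[D HD] : forall u, exists D : R, (0 < u)%R ->
  [/\ lim (diff_quot g u e @[e --> (0%R : R)^'+]) = D%:E,
    (forall v, (u < v)%R -> (D * (v - u) <= c v - c u)%R) &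
    (forall y, (forall v, (u < v)%R -> (y * (v - u) <= c v - c u)%R) -> (y <= D)%R)].
  move=> u.
  have [u0|] := boolP (0 < u)%R; last by exists 0%R.
  by have [D ?] := right_deriv_gt0 u0; exists D.
have mono : {in Interval (BRight (0%R : R)) +oo%O &,
    nondecreasing_fun (fun u => lim (diff_quot g u e @[e --> (0%R : R)^'+]))}.
  move=> u u'; rewrite !in_itv/= !andbT => u0 u'0.
  rewrite le_eqVlt => /predU1P[->//|uu].
  have [-> D1 D2] := HD _ u0; have [-> D1' D2'] := HD _ u'0.
  rewrite lee_fin; apply: D2' => v u'v.
  have := @Gamma_slope _ g gG u u' u' v (Gamma_fin gG u0)
    ltac:(lra) ltac:(lra) ltac:(lra) ltac:(lra).
  have p : (0 < u' - u)%R by lra.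
  have p' : (0 <= v - u')%R by lra.
  move=> h; rewrite -(ler_pM2r p); apply: le_trans h.
  by rewrite mulrAC; exact: ler_wpM2r p' _ _ (D1 _ uu).
have /cvg_lim -> // := nondecreasing_at_right_cvge +oo%O isT mono.
set S := _ @` _.
have lb : r%:E <= ereal_inf S.
  apply: le_ereal_inf_tmp => _ [u /= + <-]; rewrite in_itv/= andbT => u0.
  have [-> _ D2] := HD _ u0; rewrite lee_fin; apply: D2 => v uv.
  have := @Gamma_slope _ g gG 0%R u u v tf
    ltac:(lra) ltac:(lra) ltac:(lra) ltac:(lra).
  have p' : (0 <= v - u)%R by lra.
  rewrite subr0 => h; rewrite -(ler_pM2r u0); apply: le_trans h.
  by rewrite mulrAC; have := ler_wpM2r p' (ra _ u0); rewrite subr0.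
have ub u : (0 < u)%R -> ereal_inf S <= (D u)%:E.
  move=> u0; have [<- _ _] := HD _ u0.
  by apply: ereal_inf_lbound; exists u => //=; rewrite in_itv/= u0.
have Sfin : ereal_inf S \is a fin_num.
  rewrite fin_numElt (lt_le_trans _ lb) ?ltNyr//=.
  by rewrite (le_lt_trans (ub _ ltr01))// ltry.
exists (fine (ereal_inf S)); split; first by rewrite fineK.
  by rewrite -lee_fin fineK.
move=> u u0.
(* At [t = 0] the supporting line is obtained from those at [v > 0] by letting [v] tend to 0. *)
have h1 : (fine (ereal_inf S) * (u - v))%R @[v --> (0%R : R)^'+] -->
    (fine (ereal_inf S) * (u - 0))%R.
  apply: cvgMr; apply: cvgB; first exact: cvg_cst.
  exact/cvg_at_right_filter/cvg_id.
have h2 : (c u - c v)%R @[v --> (0%R : R)^'+] --> (c u - c 0)%R.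
  by apply: cvgB; [exact: cvg_cst | exact: Gamma_fine_at0].
apply: (ler_cvg_to h1 h2); near=> v.
have v0 : (0 < v)%R by [].
have vu : (v < u)%R by near: v; exact: nbhs_right_lt.
have [_ D1 _] := HD _ v0; apply: le_trans (D1 _ vu).
by rewrite ler_wpM2r// ?subr_ge0 ?(ltW vu)// -lee_fin fineK// ub.
Unshelve. all: by end_near. Qed.

Lemma left_deriv_argmax r t : is_argmax g r t -> (0 < t)%R -> exists D : R,
  [/\ left_deriv g t = D%:E, (D <= r)%R &
    forall u, (u < t)%R -> g u \is a fin_num -> (c t - c u <= D * (t - u))%R].
Proof.
move=> a t0; have tE := argmax_fine gG a; have ur : econj g r \is a fin_num by case: a.
have [D [DE D1 D2]] := left_deriv_gt0 t0.
exists D; split=> //; first by rewrite /left_deriv gt_eqF.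
apply: D2 => u ut gu; have := Young_real ur gu.
by rewrite /c tE; lra.
Qed.

(** The Young gap of [s] is [g s - g t - r * (s - t)]. Replacing [r] by the one-sided derivative on
    the side of [s] can only decrease it. *)
Lemma bregman_le_gap r s t (x : R) : is_argmax g r t ->
  g s <= (r * s - fine (econj g r) + x)%:E -> bregman g s t <= x%:E.
Proof.
move=> a gs; have s_fin := gap_fin gG gs.
have s0 := Gamma_fin_ge0 gG s_fin.
have t0 := argmax_ge0 gG a; have tf := argmax_fin gG a.
have tE := argmax_fine gG a.
have [D [DE rD D1]] := right_deriv_argmax a.
rewrite /bregman !ltNge s0 t0/= DE/= /sgn_deriv DE.
move: gs; rewrite -(fineK s_fin) -(fineK tf) lee_fin tE => gs.
rewrite subr_ge0; case: ifPn => ts.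
  rewrite -EFinM -!EFinB lee_fin.
  have : (0 <= (D - r) * (s - t))%R by rewrite mulr_ge0 ?subr_ge0.
  lra.
rewrite -ltNge in ts.
have [D' [-> rD' D1']] := left_deriv_argmax a (le_lt_trans s0 ts).
rewrite -EFinM -!EFinB lee_fin.
have : (0 <= (r - D') * (t - s))%R by rewrite mulr_ge0 ?subr_ge0// ltW.
lra.
Qed.

Lemma defect_ge0 s t : (0 <= s)%R -> g t \is a fin_num ->
  0 <= g s + g t - 2%:E * g ((s + t) / 2)%R.
Proof.
move=> s0 tf; have t0 := Gamma_fin_ge0 gG tf.
have [sf|sinf] := boolP (g s \is a fin_num); last first.
  have [s_eq0 gs] := Gamma_nfin_at0 gG s0 sinf.
  have tgt0 : (0 < t)%R.
    by rewrite lt_neqAle t0 andbT eq_sym; apply: contraNneq sinf => t_eq0;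
      rewrite s_eq0 -t_eq0.
  have m0 : (0 < (s + t) / 2)%R by lra.
  by rewrite gs -(fineK tf) -(Gamma_fineK gG m0) -EFinM addye// addye// leey.
have mf : g ((s + t) / 2)%R \is a fin_num.
  have : (0 <= (s + t) / 2)%R by lra.
  rewrite le_eqVlt => /predU1P[m0|]; last exact: Gamma_fin.
  by rewrite -m0 (_ : 0 = s)%R//; lra.
rewrite -(fineK sf) -(fineK tf) -(fineK mf) -EFinM -!EFinB lee_fin.
have [st|ts|->] := ltgtP s t.
- have := @Gamma_conv _ g gG s ((s + t) / 2)%R t sf ltac:(lra) ltac:(lra).
  have p : (0 < t - s)%R by lra.
  rewrite (_ : t - (s + t) / 2 = (t - s) / 2)%R; last lra.
  rewrite (_ : (s + t) / 2 - s = (t - s) / 2)%R; last lra.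
  by move=> h; rewrite -(pmulr_rge0 _ p); lra.
- have := @Gamma_conv _ g gG t ((s + t) / 2)%R s tf ltac:(lra) ltac:(lra).
  have p : (0 < s - t)%R by lra.
  rewrite (_ : s - (s + t) / 2 = (s - t) / 2)%R; last lra.
  rewrite (_ : (s + t) / 2 - t = (s - t) / 2)%R; last lra.
  by move=> h; rewrite -(pmulr_rge0 _ p); lra.
- by rewrite (_ : (t + t) / 2 = t)%R; lra.
Qed.

(** The supporting line at [t] on the side of [s], evaluated at the midpoint, bounds [g] there from
    below. *)
Lemma defect_le_bregman r s t : is_argmax g r t -> (0 <= s)%R ->
  g s + g t - 2%:E * g ((s + t) / 2)%R <= bregman g s t.
Proof.
move=> a s0.
have t0 := argmax_ge0 gG a; have tf := argmax_fin gG a.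
have [D [DE rD D1]] := right_deriv_argmax a.
rewrite /bregman !ltNge s0 t0/= DE/= /sgn_deriv DE.
have [st|ts|->] := ltgtP s t; last first.
- rewrite subrr lexx mule0 sube0 (_ : ((t + t) / 2 = t)%R); last lra.
  by rewrite -(fineK tf) -EFinM -EFinD -!EFinB lee_fin; lra.
- have s0' := le_lt_trans t0 ts.
  have m0 : (0 < (s + t) / 2)%R by lra.
  rewrite subr_ge0 (ltW ts) -(fineK tf) -(Gamma_fineK gG s0') -(Gamma_fineK gG m0).
  rewrite -!EFinM -!EFinB lee_fin.
  by have := D1 ((s + t) / 2)%R ltac:(lra); rewrite /c; lra.
- have t0' := le_lt_trans s0 st.
  have m0 : (0 < (s + t) / 2)%R by lra.
  have [D' [-> rD' D1']] := left_deriv_argmax a t0'.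
  rewrite subr_ge0 (leNgt t s) st/= -(fineK tf) -(Gamma_fineK gG m0).
  have [sf|/(Gamma_nfin_at0 gG s0)[_ ->]] := boolP (g s \is a fin_num); last first.
    by rewrite -EFinM addye// addye// -EFinM addye// leey.
  rewrite -(fineK sf) -!EFinM -!EFinB lee_fin.
  have := D1' ((s + t) / 2)%R ltac:(lra) (Gamma_fin gG m0).
  by rewrite /c; lra.
Qed.

End argmax_consequences.

(** * Integrals of possibly nonmeasurable functions *)

Section measure_lemmas.
Context {d : measure_display} {T : measurableType d} {R : realType}.
Variable mu : {measure set T -> \bar R}.
Implicit Types f g : T -> \bar R.

Lemma measurable_mem_set (N : set T) : measurable N ->
  measurable_fun setT (fun x => x \in N).
Proof.
move=> mN; apply: (measurable_fun_bool true); rewrite setTI.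
by rewrite (_ : _ @^-1` _ = N)//; apply/seteqP; split => x /=;
  [exact: set_mem | exact: mem_set].
Qed.

(* The integral of a nonnegative function is a supremum over the simple
   functions below it, so only one side of the comparison has to be
   measurable. *)
Lemma ge0_le_integral_nm f g : (forall x, 0 <= f x) -> (forall x, f x <= g x) ->
  \int[mu]_x f x <= \int[mu]_x g x.
Proof.
move=> f0 fg; rewrite !ge0_integralTE//; last by move=> x; exact: le_trans (fg x).
apply: le_ereal_sup => _ [h /= hf <-]; exists h => //= x.
exact: le_trans (fg x).
Qed.

(** Only the measurable side is altered on the exceptional null set, here to [+oo]; in the companion
    lemma it is set to 0. *)
Lemma ge0_ae_le_integral_measr f g : (forall x, 0 <= f x) -> (forall x, 0 <= g x) ->
  measurable_fun setT g -> {ae mu, forall x, f x <= g x} ->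
  \int[mu]_x f x <= \int[mu]_x g x.
Proof.
move=> f0 g0 mg [N [mN N0 fgN]].
pose g' x := if x \in N then +oo else g x.
have mg' : measurable_fun setT g'.
  by apply: measurable_fun_ifT => //; exact: measurable_mem_set.
have -> : \int[mu]_x g x = \int[mu]_x g' x.
  apply: ge0_ae_eq_integral => //; first by move=> x _; rewrite /g'; case: ifP.
  exists N; split=> // x /= h; apply: contrapT => xN; apply: h => _.
  by rewrite /g' memNset.
apply: ge0_le_integral_nm => // x; rewrite /g'; case: ifPn => [_|]; first exact: leey.
rewrite notin_setE; apply: contra_notP => h; exact: fgN.
Qed.

Lemma ge0_ae_le_integral_measl f g : (forall x, 0 <= f x) -> (forall x, 0 <= g x) ->
  measurable_fun setT f -> {ae mu, forall x, f x <= g x} ->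
  \int[mu]_x f x <= \int[mu]_x g x.
Proof.
move=> f0 g0 mf [N [mN N0 fgN]].
pose f' x := if x \in N then 0 else f x.
have mf' : measurable_fun setT f'.
  by apply: measurable_fun_ifT => //; exact: measurable_mem_set.
have -> : \int[mu]_x f x = \int[mu]_x f' x.
  apply: ge0_ae_eq_integral => //; first by move=> x _; rewrite /f'; case: ifP.
  exists N; split=> // x /= h; apply: contrapT => xN; apply: h => _.
  by rewrite /f' memNset.
apply: ge0_le_integral_nm => // x; rewrite /f'; case: ifPn => // xN.
by move: xN; rewrite notin_setE; apply: contra_notP => h; exact: fgN.
Qed.

(** The finite integral of [g] bounds that of the positive part of [f], which excludes the
    conventional value [+oo]. *)
Lemma uintegral_le f g : (forall x, 0 <= g x) -> measurable_fun setT g ->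
  {ae mu, forall x, f x <= g x} -> \int[mu]_x g x < +oo ->
  uintegral mu f <= \int[mu]_x g x.
Proof.
move=> g0 mg fg goo.
have le : \int[mu]_x f^\+ x <= \int[mu]_x g x.
  apply: ge0_ae_le_integral_measr => //.
  by apply: filterS fg => x fg; rewrite funeposE ge_max fg/=.
rewrite /uintegral lt_eqF ?(le_lt_trans le)// integralE.
by apply: le_trans le; rewrite -[leRHS]sube0 leeB// integral_ge0.
Qed.

Lemma le_uintegral f g : (forall x, 0 <= g x) -> measurable_fun setT g ->
  {ae mu, forall x, g x <= f x} -> \int[mu]_x g x <= uintegral mu f.
Proof.
move=> g0 mg gf; rewrite /uintegral; case: ifPn => [_|_]; first exact: leey.
have -> : \int[mu]_x f x = \int[mu]_x f^\+ x.
  rewrite integralE (_ : \int[mu]_x f^\- x = 0) ?sube0//.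
  apply/eqP; rewrite eq_le integral_ge0// andbT.
  rewrite -(integral0 mu setT); apply: ge0_ae_le_integral_measr => //.
  apply: filterS gf => x gf; rewrite funenegE ge_max lexx andbT leeNl oppe0.
  exact: le_trans gf.
apply: ge0_ae_le_integral_measl => //.
by apply: filterS gf => x gf; rewrite funeposE le_max gf.
Qed.

Lemma ae_fin_of_integral f : (forall x, 0 <= f x) -> measurable_fun setT f ->
  \int[mu]_x f x < +oo -> {ae mu, forall x, f x < +oo}.
Proof.
move=> f0 mf foo.
have /integrable_ae : mu.-integrable setT f.
  apply/integrableP; split => //.
  by under eq_integral do rewrite gee0_abs//.
move=> /(_ measurableT); apply: filterS => x /(_ I).
by rewrite fin_numElt => /andP[].
Qed.

(** A Borel-Cantelli argument: the bounds add up to [C], so the sum of the series is integrable. *)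
Lemma ae_summable (f : nat -> T -> \bar R) (C : R) : (0 <= C)%R ->
  (forall k x, 0 <= f k x) -> (forall k, measurable_fun setT (f k)) ->
  (forall k, \int[mu]_x f k x <= (C / (2 ^ k.+1)%:R)%:E) ->
  {ae mu, forall x, \sum_(k <oo) f k x < +oo}.
Proof.
move=> C0 f0 mf fC.
have : \int[mu]_x (\sum_(k <oo) f k x) < +oo.
  rewrite integral_nneseries//.
  apply: (@le_lt_trans _ _ C%:E); last exact: ltry.
  apply: le_trans (epsilon_trick0 xpredT C0).
  by apply: lee_nneseries => [k _ _|k _]; [exact: integral_ge0 | exact: fC].
apply: ae_fin_of_integral; first by move=> x; exact: nneseries_ge0.
exact: ge0_emeasurable_sum.
Qed.

Lemma ae_cvg0_of_summable (f : nat -> T -> \bar R) (C : R) : (0 <= C)%R ->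
  (forall k x, 0 <= f k x) -> (forall k, measurable_fun setT (f k)) ->
  (forall k, \int[mu]_x f k x <= (C / (2 ^ k.+1)%:R)%:E) ->
  {ae mu, forall x, f k x @[k --> \oo] --> 0}.
Proof.
move=> C0 f0 mf fC; apply: filterS (ae_summable C0 f0 mf fC) => x foo.
have := nneseries_tail_cvg foo (fun k _ => f0 k x).
apply: squeeze_cvge; last exact: cvg_cst.
apply: nearW => k; rewrite f0/=.
apply: le_trans (nneseries_lim_ge k.+1 (fun n _ _ => f0 n x)).
by rewrite big_nat1.
Qed.

End measure_lemmas.

(** Sigma-finiteness enters here: the weight [G] makes bounded functions integrable without changing
    the null sets. *)
Lemma exists_weight {d : measure_display} {T : measurableType d} {R : realType}
    (mu : {sigma_finite_measure set T -> \bar R}) :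
  exists G : T -> \bar R, [/\ measurable_fun setT G, forall x, 0 < G x &
    \int[mu]_x G x < +oo].
Proof.
have [F FT mF] := sigma_finiteT mu.
(* The mass of the [k]-th term is then at most [1 / 2 ^ k.+1], and the added 1 covers sets of
   measure 0. *)
pose w k : R := ((1 + fine (mu (F k)))^-1 / (2 ^ k.+1)%:R)%R.
have m0 k : (0 < 1 + fine (mu (F k)))%R by rewrite ltr_pwDl// fine_ge0.
have w0 k : (0 < w k)%R by rewrite divr_gt0 ?invr_gt0// ltr0n expn_gt0.
have t0 k x : 0 <= (w k * \1_(F k) x)%:E by rewrite lee_fin mulr_ge0// ltW.
have mt k : measurable_fun setT (fun x => (w k * \1_(F k) x)%:E).
  apply/measurable_EFinP; apply: measurable_funM => //.
  by apply: measurable_indic; exact: (mF k).1.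
exists (fun x => \sum_(k <oo) (w k * \1_(F k) x)%:E); split.
- exact: ge0_emeasurable_sum.
- move=> x; have [k _ Fkx] : (\bigcup_k F k) x by rewrite -FT.
  apply: (@lt_le_trans _ _ (w k * \1_(F k) x)%:E).
    by rewrite lte_fin indicE mem_set// mulr1.
  apply: le_trans (nneseries_lim_ge k.+1 (fun n _ _ => t0 n x)).
  by rewrite big_nat_recr//= leeDr// sume_ge0.
- rewrite integral_nneseries//.
  apply: (@le_lt_trans _ _ 1%:E); last exact: ltry.
  apply: le_trans (epsilon_trick0 xpredT ler01).
  apply: lee_nneseries => [k _ _|k _]; first exact: integral_ge0.
  under eq_integral do rewrite EFinM.
  rewrite ge0_integralZl//; last by rewrite lee_fin ltW.
    rewrite integral_indic//; last exact: (mF k).1.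
    have Ffin : mu (F k) \is a fin_num by rewrite ge0_fin_numE// (mF k).2.
    rewrite setIT -[X in _ * X](fineK Ffin) -EFinM lee_fin /w mulrAC.
    rewrite ler_pM2r ?invr_gt0 ?ltr0n ?expn_gt0//.
    by rewrite ler_pdivrMl// mulr1 lerDr.
  by apply/measurable_EFinP; apply: measurable_indic; exact: (mF k).1.
Qed.

(** * Joint measurability of the integrand and its conjugate *)

Section integrand_measurability.
Context {d : measure_display} {Z : measurableType d} {R : realType}.
Variables (beta : Z -> R -> \bar R) (betaB : Bclass beta).

(** For [t > 0], squeeze [g] between the cone at [t] and the chord to [t + 1]. *)
Lemma Gamma_right_cvg (g : R -> \bar R) t : Gamma g ->
  g x @[x --> t^'+] --> g t.
Proof.
move=> gG; have [t0|t0|->] := ltgtP t 0%R.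
- rewrite (Gamma_neg gG t0); apply: cvg_near_cst.
  near=> x; apply: (Gamma_neg gG); near: x; exact: nbhs_right_lt.
- have [L L0 cL] := Gamma_cone gG t0.
  pose M : R := (fine (g (t + 1)) - fine (g t))%R.
  apply: (@squeeze_cvge _ _ _ _ (fun x => (fine (g t) - L * `|x - t|)%:E) _
    (fun x => (fine (g t) + M * (x - t))%:E)).
  + near=> x; rewrite cL/=.
    have tx : (t < x)%R by near: x; exact: nbhs_right_gt.
    have xt1 : (x < t + 1)%R by near: x; apply: nbhs_right_lt; rewrite ltrDl.
    have x0 := lt_trans t0 tx.
    rewrite -(Gamma_fineK gG x0) lee_fin.
    have := Gamma_conv gG (Gamma_fin gG t0) tx xt1.
    by rewrite /M; lra.
  + rewrite -[X in _ --> X](Gamma_fineK gG t0); apply: cvg_EFin; first exact: nearW.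
    rewrite -[X in _ --> X]subr0; apply: cvgB; first exact: cvg_cst.
    rewrite -(mulr0 L); apply: cvgMr; rewrite -(@normr0 _ R) -(subrr t).
    apply: cvg_norm; apply: cvgB; last exact: cvg_cst.
    exact/cvg_at_right_filter/cvg_id.
  + rewrite -[X in _ --> X](Gamma_fineK gG t0); apply: cvg_EFin; first exact: nearW.
    rewrite -[X in _ --> X]addr0; apply: cvgD; first exact: cvg_cst.
    rewrite -(mulr0 M); apply: cvgMr; rewrite -(subrr t).
    apply: cvgB; last exact: cvg_cst.
    exact/cvg_at_right_filter/cvg_id.
- exact: Gamma_at0.
Unshelve. all: by end_near. Qed.

Lemma measurable_Bclass_comp (s : Z -> R) : measurable_fun setT s ->
  measurable_fun setT (fun z => beta z (s z)).
Proof.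
move=> ms.
pose fl k z : int := Num.floor (s z * k.+1%:R).
(* Adding 1 to the floor puts the grid point strictly to the right of [s z], as right continuity
   requires; each [sk k] has countably many values. *)
pose sk k z : R := ((fl k z + 1)%:~R / k.+1%:R)%R.
have k0 k : (0 < k.+1%:R :> R)%R by rewrite ltr0n.
apply: (emeasurable_fun_cvg (fun k z => beta z (sk k z))) => [k|z _].
  move=> _ Y mY; rewrite setTI.
  rewrite (_ : _ @^-1` Y = \bigcup_(i : int) ([set z | fl k z = i] `&`
    (fun z => beta z ((i + 1)%:~R / k.+1%:R)%R) @^-1` Y)); last first.
    apply/seteqP; split=> [z /= Yz|z [i _ [/= <-]]//]; by exists (fl k z).
  apply: countable_bigcupT_measurable => // i; apply: measurableI; last first.
    by rewrite -[_ @^-1` _]setTI; exact: (Bclass_measurable betaB).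
  rewrite (_ : [set z | _] = s @^-1` `[(i%:~R / k.+1%:R)%R, ((i + 1)%:~R / k.+1%:R)%R[).
    by rewrite -[_ @^-1` _]setTI; exact: ms.
  apply/seteqP; split=> z /=; rewrite in_itv/= ler_pdivrMr// ltr_pdivlMr//.
    by move=> <-; exact: floor_itv.
  by move=> h; exact: floor_def.
have sgt k : (s z < sk k z)%R.
  by rewrite /sk ltr_pdivlMr//; have /andP[] := floor_itv (s z * k.+1%:R).
have sle k : (sk k z <= s z + k.+1%:R^-1)%R.
  rewrite /sk ler_pdivrMr// mulrDl mulVf ?gt_eqF// intrD.
  by rewrite lerD2r; have /andP[] := floor_itv (s z * k.+1%:R).
have scvg : sk k z @[k --> \oo] --> s z.
  apply: (@squeeze_cvgr _ _ _ _ (fun=> s z) (fun k => s z + k.+1%:R^-1)%R).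
  - by apply: nearW => k; rewrite sle (ltW (sgt k)).
  - exact: cvg_cst.
  - rewrite -[X in _ --> X]addr0; apply: cvgD; first exact: cvg_cst.
    exact: cvg_harmonic.
have skr : sk k z @[k --> \oo] --> (s z)^'+.
  move=> P; rewrite /at_right /within/= => nP.
  have : \forall k \near \oo, (s z < sk k z)%R -> P (sk k z) by exact: (scvg _ nP).
  by move=> [N NT h]; exists N => // k Nk; exact: h k Nk (sgt k).
exact: cvg_comp skr (Gamma_right_cvg (Bclass_Gamma betaB z)).
Qed.

(** Right continuity lets rationals replace reals in the supremum. Codes of no rational give the
    slope 0, itself a legitimate competitor. *)
Lemma econj_rat (g : R -> \bar R) r : Gamma g ->
  econj g r = esups (fun k : nat => let q : R := ratr (odflt 0%R (unpickle k)) in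
    (r * q)%:E - g q) 0%N.
Proof.
move=> gG; set u := (X in esups X); apply/eqP; rewrite eq_le; apply/andP; split.
  apply: ge_ereal_sup => _ [t _ <-].
  have [gt|] := boolP (g t \is a fin_num); last first.
    rewrite fin_numEn => /orP[/eqP gt|/eqP->]; last by rewrite leNye.
    by have := Gamma_ltNy gG t; rewrite gt.
  rewrite leNgt; apply/negP => lt.
  have c : (r * x)%:E - g x @[x --> t^'+] --> (r * t)%:E - g t.
    apply: cvgeB; first by rewrite fin_num_adde_defr.
      apply: cvg_EFin; first exact: nearW.
      by apply: cvgMr; exact/cvg_at_right_filter/cvg_id.
    exact: Gamma_right_cvg.
  have N : nbhs ((r * t)%:E - g t) [set y | esups u 0%N < y].
    by apply: open_nbhs_nbhs; split => //; exact: open_ereal_gt_ereal.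
  have : \forall x \near t^'+, esups u 0%N < (r * x)%:E - g x by exact: (c _ N).
  rewrite /at_right near_withinE => /nbhs_ballP[e /= e0 H].
  have tte : (t < t + e)%R by rewrite ltrDl.
  have [q] := rat_in_itvoo tte; rewrite in_itv/= => /andP[tq qte].
  have : esups u 0%N < (r * ratr q)%:E - g (ratr q).
    by apply: H => //=; rewrite /ball/= ltr0_norm ?subr_lt0// opprB ltrBlDl.
  rewrite ltNge => /negP; apply; apply: ereal_sup_ubound.
  by exists (pickle q) => //=; rewrite /u pickleK.
apply: ge_ereal_sup => _ [k _ <-]; rewrite /u; exact: econj_Young.
Qed.

Lemma measurable_econj (r : Z -> R) : measurable_fun setT r ->
  measurable_fun setT (fun z => econj (beta z) (r z)).
Proof.
move=> mr; rewrite (_ : (fun _ => _) = fun z => esups (fun k : nat =>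
    let q : R := ratr (odflt 0%R (unpickle k)) in (r z * q)%:E - beta z q) 0%N).
  apply: measurable_fun_esups => k.
  apply: emeasurable_funB; last exact: (Bclass_measurable betaB).
  by apply/measurable_EFinP; exact: measurable_funM.
by apply/funext => z; rewrite econj_rat//; exact: (Bclass_Gamma betaB).
Qed.

End integrand_measurability.

(** * The dual objective *)

Section dual_problem.
Context {d : measure_display} {Z : measurableType d} {R : realType} {n : nat}.
Variables (mu : {measure set Z -> \bar R}) (phi : Z -> 'rV[R]_n)
  (beta : Z -> R -> \bar R) (a : 'rV[R]_n).
Hypotheses (phi_meas : forall i : 'I_n, measurable_fun setT (fun z => phi z 0%R i))
  (betaB : Bclass beta) (Ka_fin : Kconj mu phi beta a \is a fin_num).
Implicit Types (theta vartheta : 'rV[R]_n) (l : R).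

Local Notation KK := (K mu phi beta).
Local Notation Th := (Theta mu phi beta).
Local Notation bG := (Bclass_Gamma betaB).

Definition conj_at theta z : R := fine (econj (beta z) (dot theta (phi z))).

Definition blend l theta vartheta : 'rV[R]_n := ((1 - l) *: theta + l *: vartheta)%R.

Lemma dot_blend l theta vartheta v :
  dot (blend l theta vartheta) v = ((1 - l) * dot theta v + l * dot vartheta v)%R.
Proof.
rewrite /dot !mulr_sumr -big_split/=; apply: eq_bigr => i _.
by rewrite !mxE mulrDl !mulrA.
Qed.

Lemma measurable_dot theta : measurable_fun setT (fun z => dot theta (phi z)).
Proof.
by apply: measurable_sum => i; apply: measurable_funM => //; exact: measurable_cst.
Qed.

Lemma measurable_integrand theta :
  measurable_fun setT (fun z => econj (beta z) (dot theta (phi z))).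
Proof. by apply: measurable_econj => //; exact: measurable_dot. Qed.

Lemma measurable_conj_at theta : measurable_fun setT (conj_at theta).
Proof. exact: measurableT_comp (measurable_integrand theta). Qed.

(** A value [-oo] would make the supremum [Kconj] equal to [+oo]. *)
Lemma K_gtNy theta : -oo < KK theta.
Proof.
rewrite ltNye; apply/eqP => KNy.
have : (dot theta a)%:E - KK theta <= Kconj mu phi beta a.
  by apply: ereal_sup_ubound; exists theta.
by rewrite KNy /= leye_eq; apply/negP; move: Ka_fin; case: Kconj.
Qed.

Lemma integrable_integrand theta : KK theta < +oo ->
  mu.-integrable setT (fun z => econj (beta z) (dot theta (phi z))) /\
  KK theta = \int[mu]_z econj (beta z) (dot theta (phi z)).
Proof.
move=> Koo; have KNy := K_gtNy theta; move: Koo KNy.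
have mF := measurable_integrand theta.
rewrite /K /uintegral; set F := (fun z => econj (beta z) (dot theta (phi z))).
case: ifPn => // Fp _; rewrite integralE => Fn; split=> //.
apply/integrableP; split; first exact: mF.
rewrite [X in X < _](_ : _ = \int[mu]_z F^\+ z + \int[mu]_z F^\- z); last first.
  rewrite -ge0_integralD//; last 2 first.
  - exact: (measurable_funepos mF).
  - exact: (measurable_funeneg mF).
  by apply: eq_integral => z _; have /(congr1 (fun f => f z)) := fune_abse F.
rewrite lte_add_pinfty// ltey//.
by apply: contraTN Fn => /eqP ->; rewrite addeNy ltxx.
Qed.

Lemma integrable_conj_at theta : KK theta < +oo ->
  [/\ mu.-integrable setT (EFin \o conj_at theta),
    fine (KK theta) = (\int[mu]_z conj_at theta z)%R &
    {ae mu, forall z, econj (beta z) (dot theta (phi z)) \is a fin_num}].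
Proof.
move=> /integrable_integrand[iF KE].
have aeF : {ae mu, forall z, econj (beta z) (dot theta (phi z)) \is a fin_num}.
  by have := integrable_ae measurableT iF; apply: filterS => z; exact.
split=> //.
- apply: le_integrable iF => //; first exact/measurable_EFinP/measurable_conj_at.
  by move=> z _ /=; rewrite /conj_at; case: econj => [x||] //=; exact: leey.
- rewrite KE; congr fine; apply: ae_eq_integral => //.
  + exact: measurable_integrand.
  + exact/measurable_EFinP/measurable_conj_at.
  + by apply: filterS aeF => z ? _; rewrite /conj_at fineK.
Qed.

(** The distance of [theta] from the dual optimum, meaningful when [K theta] is finite. *)
Definition subopt theta : R :=
  (fine (Kconj mu phi beta a) - (dot theta a - fine (KK theta)))%R.

Lemma suboptE theta : KK theta < +oo ->
  Kconj mu phi beta a - ((dot theta a)%:E - KK theta) = (subopt theta)%:E.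
Proof.
move=> Koo; have Kfin : KK theta \is a fin_num by rewrite fin_numElt K_gtNy.
by rewrite -[in LHS](fineK Kfin) -[in LHS](fineK Ka_fin).
Qed.

Lemma subopt_ge0 theta : KK theta < +oo -> (0 <= subopt theta)%R.
Proof.
move=> Koo; rewrite -lee_fin -suboptE//.
have Kfin : KK theta \is a fin_num by rewrite fin_numElt K_gtNy.
rewrite sube_ge0 ?Ka_fin ?orbT//.
by apply: ereal_sup_ubound; exists theta.
Qed.

Definition jensen_gap l theta vartheta z : R :=
  ((1 - l) * conj_at theta z + l * conj_at vartheta z
    - conj_at (blend l theta vartheta) z)%R.

Lemma measurable_jensen_gap l theta vartheta :
  measurable_fun setT (jensen_gap l theta vartheta).
Proof.
apply: measurable_funB; last exact: measurable_conj_at.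
by apply: measurable_funD; apply: measurable_funM; try exact: measurable_cst;
  exact: measurable_conj_at.
Qed.

Lemma blend_convex l theta vartheta z : (0 <= l <= 1)%R ->
  econj (beta z) (dot theta (phi z)) \is a fin_num ->
  econj (beta z) (dot vartheta (phi z)) \is a fin_num ->
  econj (beta z) (dot (blend l theta vartheta) (phi z)) <=
    ((1 - l) * conj_at theta z + l * conj_at vartheta z)%:E.
Proof. by move=> l01 u u'; rewrite dot_blend; exact: (econj_convex (bG z)). Qed.

Lemma integrable_conv l theta vartheta : KK theta < +oo -> KK vartheta < +oo ->
  mu.-integrable setT
    (EFin \o (fun z => (1 - l) * conj_at theta z + l * conj_at vartheta z)%R).
Proof.
move=> /integrable_conj_at[i _ _] /integrable_conj_at[i' _ _].
exact: (integrableD measurableT (integrableZl measurableT _ i)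
  (integrableZl measurableT _ i')).
Qed.

Lemma K_blend l theta vartheta : (0 <= l <= 1)%R ->
  KK theta < +oo -> KK vartheta < +oo -> KK (blend l theta vartheta) < +oo.
Proof.
move=> l01 Kt Kv.
have [_ _ ft] := integrable_conj_at Kt; have [_ _ fv] := integrable_conj_at Kv.
have i := integrable_conv l Kt Kv.
set b := (X in EFin \o X) in i.
have boo : \int[mu]_z `|(b z)%:E| < +oo by have /integrableP[] := i.
apply: le_lt_trans boo; apply: uintegral_le => //.
- by apply: measurableT_comp => //; have /integrableP[] := i.
- move: fv; apply: filterS2 ft => z uz vz.
  apply: le_trans (blend_convex l01 uz vz) _.
  by rewrite lee_fin ler_norm.
- by have /integrableP[] := i.
Qed.

(** The terms [dot _ a] cancel by linearity, leaving the concavity defect of the dual objective. The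
    absolute value makes the integrand nonnegative also on the null set where a conjugate is
    infinite. *)
Lemma jensen_gap_integral l theta vartheta : (0 <= l <= 1)%R ->
  KK theta < +oo -> KK vartheta < +oo ->
  \int[mu]_z `|jensen_gap l theta vartheta z|%:E =
  ((1 - l) * subopt theta + l * subopt vartheta - subopt (blend l theta vartheta))%:E.
Proof.
move=> l01 Kt Kv; have Kw := K_blend l01 Kt Kv.
have [it Et ft] := integrable_conj_at Kt; have [iv Ev fv] := integrable_conj_at Kv.
have [iw Ew _] := integrable_conj_at Kw.
have ic := integrable_conv l Kt Kv.
have ig : mu.-integrable setT (EFin \o jensen_gap l theta vartheta).
  exact: (integrableB measurableT ic iw).
transitivity (\int[mu]_z (jensen_gap l theta vartheta z)%:E).
  apply: ae_eq_integral => //.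
  - apply/measurable_EFinP; apply: measurableT_comp => //.
    exact: measurable_jensen_gap.
  - exact/measurable_EFinP/measurable_jensen_gap.
  - move: fv; apply: filterS2 ft => z uz vz _.
    rewrite ger0_norm// /jensen_gap subr_ge0 -lee_fin.
    have le := blend_convex l01 uz vz.
    rewrite [X in X <= _]fineK//.
    by apply: (econj_fin (bG z)); apply: le_lt_trans le _; rewrite ltry.
rewrite -(fineK (integrable_fin_num measurableT ig)) -/(Rintegral _ _ _).
congr (_%:E); rewrite /jensen_gap RintegralB// RintegralD//; last 2 first.
- exact: (integrableZl measurableT _ it).
- exact: (integrableZl measurableT _ iv).
rewrite !RintegralZl// -Et -Ev -Ew /subopt dot_blend.
move: (fine (Kconj mu phi beta a)) (fine (KK theta)) (fine (KK vartheta))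
  (fine (KK (blend l theta vartheta))) (dot theta a) (dot vartheta a) => *; ring.
Qed.

Lemma subopt_blend l theta vartheta : (0 <= l <= 1)%R ->
  KK theta < +oo -> KK vartheta < +oo ->
  (subopt (blend l theta vartheta) <= (1 - l) * subopt theta + l * subopt vartheta)%R.
Proof.
move=> l01 Kt Kv; rewrite -subr_ge0 -lee_fin -jensen_gap_integral//.
by apply: integral_ge0 => z _; rewrite lee_fin.
Qed.

Lemma jensen_gap_integral_le l theta vartheta : (0 <= l <= 1)%R ->
  KK theta < +oo -> KK vartheta < +oo ->
  \int[mu]_z `|jensen_gap l theta vartheta z|%:E <=
  ((1 - l) * subopt theta + l * subopt vartheta)%:E.
Proof.
move=> l01 Kt Kv; rewrite jensen_gap_integral// lee_fin lerBlDr lerDl.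
exact/subopt_ge0/K_blend.
Qed.

(** A margin [e] of finiteness at [vartheta] becomes a margin [l * e] at the blend, which is why [l]
    must be positive. *)
Lemma Theta_blend l theta vartheta : (0 < l <= 1)%R ->
  KK theta < +oo -> Th vartheta -> Th (blend l theta vartheta).
Proof.
move=> /andP[l0 l1] Kt [Kv nv]; have l01 : (0 <= l <= 1)%R by rewrite (ltW l0).
split; first exact: K_blend.
have [_ _ ft] := integrable_conj_at Kt.
move: nv; apply: filterS2 ft => z uz vz.
have vfin := fin_near_fin vz.
have [e e0 ve] := (fin_nearP (bG z) _).1 vz.
apply/(fin_nearP (bG z)); exists (l * e)%R; first exact: mulr_gt0.
rewrite dot_blend -addrA -mulrDr.
apply: le_lt_trans (econj_convex (bG z) l01 uz (econj_fin (bG z) ve)) _.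
exact: ltry.
Qed.

(** The supremum [Kconj] runs over all parameters; blending a near-optimal one slightly with
    [vartheta] brings it into [Theta]. *)
Lemma Theta_approx vartheta (e : R) : Th vartheta -> (0 < e)%R ->
  exists2 theta, Th theta & (subopt theta <= e)%R.
Proof.
move=> vT e0; have Kv := vT.1.
have : (fine (Kconj mu phi beta a) - e / 2)%:E < Kconj mu phi beta a.
  by rewrite -[ltRHS](fineK Ka_fin) lte_fin ltrBlDr ltrDl divr_gt0.
move=> /ereal_sup_gt[_ [theta _ <-]] lt.
have Kt : KK theta < +oo.
  by move: lt; case: (KK theta) => // x _; rewrite ltry.
have Kfin : KK theta \is a fin_num by rewrite fin_numElt K_gtNy.
have s1 : (subopt theta < e / 2)%R.
  by move: lt; rewrite -(fineK Kfin) -EFinB lte_fin /subopt ltrBlDr ltrBlDl.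
have s0 := subopt_ge0 Kv.
(* This weight makes [l * subopt vartheta] at most [e / 2]; the summand [e / 2] in the denominator
   ensures [l <= 1]. *)
pose l := (e / 2 / (e / 2 + subopt vartheta))%R.
have e2 : (0 < e / 2)%R by rewrite divr_gt0.
have D0 : (0 < e / 2 + subopt vartheta)%R by rewrite ltr_pwDl.
have l0 : (0 < l)%R by rewrite divr_gt0.
have l1 : (l <= 1)%R by rewrite ler_pdivrMr// mul1r lerDl.
have ls : (l * subopt vartheta <= e / 2)%R.
  by rewrite /l mulrAC ler_pdivrMr// ler_pM2l// lerDr ltW.
exists (blend l theta vartheta); first by apply: Theta_blend => //; rewrite l0.
have l01 : (0 <= l <= 1)%R by rewrite (ltW l0).
apply: le_trans (subopt_blend l01 Kt Kv) _.
have t0 := subopt_ge0 Kt.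
have : ((1 - l) * subopt theta <= subopt theta)%R.
  by rewrite ler_piMl// gerBl ltW.
by move=> h; rewrite (splitr e); apply: lerD; [exact: le_trans h (ltW s1) | exact: ls].
Qed.

(* A measurable function equal to [f_ phi beta theta] wherever the conjugate is
   finite near the evaluation point: the derivative along the steps 1/(k+1). *)
Definition primal theta z : R := fine (limn_esup (fun k =>
  (econj (beta z) (dot theta (phi z) + k.+1%:R^-1)%R
    - econj (beta z) (dot theta (phi z))) * (k.+1%:R)%:E)).

Lemma measurable_primal theta : measurable_fun setT (primal theta).
Proof.
apply: measurableT_comp; first exact: fine_measurable.
apply: measurable_fun_limn_esup => k; apply: emeasurable_funM; last exact: measurable_cst.
apply: emeasurable_funB; last exact: measurable_integrand.
apply: measurable_econj => //; apply: measurable_funD; last exact: measurable_cst.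
exact: measurable_dot.
Qed.

Lemma ae_primal theta : Th theta -> {ae mu, forall z,
  [/\ fin_near (econj (beta z)) (dot theta (phi z)),
    is_argmax (beta z) (dot theta (phi z)) (primal theta z) &
    f_ phi beta theta z = primal theta z]}.
Proof.
move=> [_]; apply: filterS => z nz.
have [df am] := econj_ederiv (bG z) nz.
have fE : primal theta z = ederiv (econj (beta z)) (dot theta (phi z)).
  by rewrite /primal (cvg_limn_einf_sup (econj_quot_cvg (bG z) nz)).2.
by split; rewrite // ?fE// /f_; case: asboolP.
Qed.

End dual_problem.

(* If the Jensen gap between [r] and [r'] is small, the two maximizers are
   close, since both have a small midpoint defect with the maximizer at the
   midpoint. *)
Lemma recip_osc {R : realType} (g : R -> \bar R) (eta : R) : Gamma g ->
  (0 < eta)%R -> exists2 delta : R, (0 < delta)%R &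
  forall r r' t t' s : R,
    is_argmax g r t -> is_argmax g r' t' ->
    is_argmax g ((1 - 2^-1) * r + 2^-1 * r')%R s ->
    (`|(1 - 2^-1) * fine (econj g r) + 2^-1 * fine (econj g r')
      - fine (econj g ((1 - 2^-1) * r + 2^-1 * r'))| <= delta)%R ->
    (`|recip t - recip t'| < eta)%R.
Proof.
move=> gG eta0; have [d d0 H] := defect_recip gG (divr_gt0 eta0 (@ltr0n R 2)).
exists (d / 2)%R; first by rewrite divr_gt0.
move=> r r' t t' s at_ at' as_; set gap := (X in `|X|%R) => gapd.
have h01 : (0 <= (2^-1 : R) <= 1)%R by rewrite invr_ge0 ler0n/= invf_le1// ler1n.
have h0 : (0 < 2^-1 :> R)%R by rewrite invr_gt0.
have h1 : (2^-1 < 1 :> R)%R by rewrite invf_lt1// ltr1n.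
have [+ +] := jensen_gap_Young gG h01 erefl (proj1 at_) (proj1 at') as_.
rewrite -/gap => /(_ h0) g1 /(_ h1) g2.
have gd : (gap / 2^-1 <= d)%R.
  by have := ler_norm gap; rewrite invrK; lra.
have gd' : (gap / (1 - 2^-1) <= d)%R.
  by rewrite (_ : 1 - 2^-1 = 2^-1)%R//; lra.
have s0 := argmax_ge0 gG as_.
have cl q u : is_argmax g q u ->
    g s <= (q * s - fine (econj g q) + d)%:E ->
    (`|recip s - recip u| < eta / 2)%R.
  move=> au gs; apply: H => //; first exact: argmax_ge0 au.
  rewrite -[d]addr0; apply: (gap_defect gG (proj1 au) gs).
  by rewrite addr0; exact: (proj2 au).
have c1 : (`|recip s - recip t| < eta / 2)%R.
  by apply: cl at_ _; apply: le_trans g2 _; rewrite lee_fin lerD2l.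
have c2 : (`|recip s - recip t'| < eta / 2)%R.
  by apply: cl at' _; apply: le_trans g1 _; rewrite lee_fin lerD2l.
rewrite (splitr eta) (le_lt_trans (ler_distD (recip s) _ _))//.
by rewrite distrC ltrD.
Qed.

(** * Uniform closeness of near-optimal primal functions *)

Section generalized_solution.
Context {d : measure_display} {Z : measurableType d} {R : realType} {n : nat}.
Variables (mu : {measure set Z -> \bar R}) (phi : Z -> 'rV[R]_n)
  (beta : Z -> R -> \bar R) (a : 'rV[R]_n).
Hypotheses (phi_meas : forall i : 'I_n, measurable_fun setT (fun z => phi z 0%R i))
  (betaB : Bclass beta) (Ka_fin : Kconj mu phi beta a \is a fin_num).
Variables (G : Z -> \bar R) (mG : measurable_fun setT G) (G0 : forall z, 0 < G z)
  (Goo : \int[mu]_z G z < +oo).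
Implicit Types (theta vartheta : 'rV[R]_n) (l : R).

Local Notation KK := (K mu phi beta).
Local Notation Th := (Theta mu phi beta).
Local Notation bG := (Bclass_Gamma betaB).
Local Notation so := (subopt mu phi beta a).
Local Notation ff := (primal phi beta).

Definition rdist theta theta' z : R := `|recip (ff theta z) - recip (ff theta' z)|%R.

Lemma measurable_recip (f : Z -> R) : measurable_fun setT f ->
  measurable_fun setT (fun z => recip (f z)).
Proof.
move=> mf; rewrite (_ : (fun _ => _) = recip \o f)//.
apply: measurableT_comp mf; apply: continuous_measurable_fun.
move=> x; apply: cvgV; first by rewrite gt_eqF// ltr_pwDl.
by apply: cvgD; [exact: cvg_cst | exact: norm_continuous].
Qed.

Lemma measurable_rdist theta theta' : measurable_fun setT (rdist theta theta').
Proof.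
apply: measurableT_comp => //; apply: measurable_funB.
- exact/measurable_recip/measurable_primal.
- exact/measurable_recip/measurable_primal.
Qed.

Lemma G_fin : {ae mu, forall z, G z \is a fin_num}.
Proof.
have := ae_fin_of_integral (fun z => ltW (G0 z)) mG Goo.
by apply: filterS => z Gz; rewrite ge0_fin_numE// ltW.
Qed.

Lemma half01 : (0 < (2^-1 : R) <= 1)%R.
Proof. by rewrite invr_gt0 ltr0n/= invf_le1// ler1n. Qed.

(** By contradiction: take bad pairs with suboptimality at most [1 / 2 ^ k.+1]. Their Jensen gaps at
    the midpoint tend to 0 almost everywhere, hence so do the distances, and dominated convergence
    with bound [G] contradicts badness. *)
Lemma oscillation (rho : R) : (0 < rho)%R -> exists2 e : R, (0 < e)%R &
  forall theta theta', Th theta -> Th theta' ->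
    (so theta <= e)%R -> (so theta' <= e)%R ->
    \int[mu]_z (G z * (rdist theta theta' z)%:E) <= rho%:E.
Proof.
move=> rho0; apply: contrapT => /forall2NP H.
have {H} H k : exists p : 'rV[R]_n * 'rV[R]_n,
    [/\ Th p.1, Th p.2, (so p.1 <= 1 / (2 ^ k.+1)%:R)%R,
      (so p.2 <= 1 / (2 ^ k.+1)%:R)%R &
      rho%:E < \int[mu]_z (G z * (rdist p.1 p.2 z)%:E)].
  have [/negP[]|] := H (1 / (2 ^ k.+1)%:R)%R.
    by rewrite divr_gt0// ltr0n expn_gt0.
  move=> /existsNP[t /existsNP[t' /not_implyP[Tt /not_implyP[Tt'
    /not_implyP[st /not_implyP[st' /negP]]]]]].
  by rewrite -ltNge => lt; exists (t, t'); exact: And5 Tt Tt' st st' lt.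
have {H} [p Hp] := choice H.
have T1 k : Th (p k).1 by have [] := Hp k.
have T2 k : Th (p k).2 by have [] := Hp k.
pose w k := blend 2^-1 (p k).1 (p k).2.
have Tw k : Th (w k).
  exact: (Theta_blend phi_meas betaB Ka_fin half01 (proj1 (T1 k)) (T2 k)).
have gap0 : {ae mu, forall z,
    `|jensen_gap phi beta 2^-1 (p k).1 (p k).2 z|%:E @[k --> \oo] --> 0}.
  apply: (@ae_cvg0_of_summable _ _ _ mu
    (fun k z => `|jensen_gap phi beta 2^-1 (p k).1 (p k).2 z|%:E) 1%R) => // [k|k].
    apply/measurable_EFinP; apply: measurableT_comp => //.
    exact: measurable_jensen_gap.
  have [_ _ s1 s2 _] := Hp k.
  have /andP[h0 h1] := half01.
  apply: le_trans (jensen_gap_integral_le phi_meas betaB Ka_fin _ _ _) _.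
  - by rewrite (ltW h0).
  - by case: (T1 k).
  - by case: (T2 k).
  - rewrite lee_fin; move: s1 s2 h0 h1.
    move: (so (p k).1) (so (p k).2) (1 / (2 ^ k.+1)%:R)%R => x y e xe ye h0 h1.
    lra.
have ae1 : {ae mu, forall z, forall k,
    is_argmax (beta z) (dot (p k).1 (phi z)) (ff (p k).1 z)}.
  by apply: ae_foralln => k; apply: filterS (ae_primal betaB (T1 k)) => z [].
have ae2 : {ae mu, forall z, forall k,
    is_argmax (beta z) (dot (p k).2 (phi z)) (ff (p k).2 z)}.
  by apply: ae_foralln => k; apply: filterS (ae_primal betaB (T2 k)) => z [].
have ae3 : {ae mu, forall z, forall k,
    is_argmax (beta z) (dot (w k) (phi z)) (ff (w k) z)}.
  by apply: ae_foralln => k; apply: filterS (ae_primal betaB (Tw k)) => z [].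
pose F k z := G z * (rdist (p k).1 (p k).2 z)%:E.
have mF k : measurable_fun setT (F k).
  by apply: emeasurable_funM => //; exact/measurable_EFinP/measurable_rdist.
have F0 : {ae mu, forall z, setT z -> F k z @[k --> \oo] --> 0}.
  apply: filterS3 (filterI ae1 ae2) (filterI ae3 gap0) G_fin.
  move=> z [a1 a2] [a3 g0] Gz _; rewrite -(mule0 (G z)); apply: cvgeZl => //.
  apply: cvg_EFin; first exact: nearW.
  apply/cvgrPdist_lt => eta eta0.
  have [dl dl0 Hd] := recip_osc (bG z) eta0.
  move: g0 => /fine_cvgP[_ /cvgrPdist_lt/(_ _ dl0)]; apply: filterS => k /=.
  rewrite !sub0r !normrN !normr_id => gk.
  rewrite /rdist.
  apply: (Hd (dot (p k).1 (phi z)) (dot (p k).2 (phi z)) _ _ (ff (w k) z)).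
  - exact: a1.
  - exact: a2.
  - by rewrite -dot_blend; exact: a3.
  - by rewrite -dot_blend; exact: ltW.
have dom : {ae mu, forall z, forall k, setT z -> `|F k z| <= G z}.
  apply: aeW => z k _; rewrite /F abseM (gee0_abs (ltW (G0 z))).
  rewrite -[leRHS]mule1; apply: lee_wpmul2l; first exact: ltW.
  by rewrite abse_EFin lee_fin normr_id recip_dist_le1.
have iG : mu.-integrable setT G.
  apply/integrableP; split=> //.
  by under eq_integral do rewrite gee0_abs ?(ltW (G0 _))//.
have [_ _ Fl] := dominated_convergence measurableT mF (measurable_cst _) F0 iG dom.
move: Fl; rewrite integral0 => /fine_cvgP[+ /cvgrPdist_lt/(_ _ rho0)].
move=> Ffin Flt.
have [k [k1 k2]] := @filter_ex _ \oo _ _ (filterI Ffin Flt).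
have k3 : rho%:E < \int[mu]_z F k z by have [] := Hp k.
have {}k1 : \int[mu]_z F k z \is a fin_num by exact: k1.
move: k3; rewrite -(fineK k1) lte_fin => k3.
move: k2; rewrite /= sub0r normrN => /(le_lt_trans (ler_norm _)).
by move=> /(lt_trans k3); rewrite ltxx.
Qed.

End generalized_solution.

(** * Subsequences and pointwise limits *)

Section limits_of_sequences.
Context {R : realType}.
Implicit Types (u v : nat -> \bar R).

Lemma limn_einf_le_cvg u v l : (forall k, u k <= v k) -> v @ \oo --> l ->
  limn_einf u <= l.
Proof.
move=> uv vl; rewrite limn_einf_lim -(cvg_lim _ vl)//.
apply: lee_lim; [exact: is_cvg_einfs | by apply/cvg_ex; exists l |].
apply: nearW => k; apply: le_trans (uv k).
by apply: ereal_inf_lbound; exists k => /=.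
Qed.

Lemma limn_einf_lt_frequently u l : limn_einf u < l ->
  exists s : nat -> nat, forall j, (j <= s j)%N /\ u (s j) < l.
Proof.
move=> ul; suff H j : exists k, (j <= k)%N /\ u k < l.
  by have [s Hs] := choice H; exists s.
have : einfs u j < l.
  apply: le_lt_trans ul; rewrite limn_einf_lim (cvg_lim _ (@cvg_einfs_sup _ u))//.
  by apply: ereal_sup_ubound; exists j.
by move=> /ereal_inf_lt[_ [k /= jk <-] kl]; exists k.
Qed.

Lemma cvg_subseq (x : nat -> R) (l : R) (s : nat -> nat) :
  (forall j, (j <= s j)%N) -> x @ \oo --> l -> x (s j) @[j --> \oo] --> l.
Proof.
move=> js xl P /xl[N _ HN]; exists N => // j /= Nj.
by apply: HN => /=; exact: leq_trans Nj (js j).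
Qed.

(** Absolute convergence of the telescoping series. The factor [x] is the weight [G] at a point. *)
Lemma cvg_summable_steps (x : \bar R) (q : nat -> R) : 0 < x -> x \is a fin_num ->
  \sum_(k <oo) (x * `|q k - q k.+1|%:E) < +oo -> cvgn q.
Proof.
move=> x0 xfin; set S := (X in X < _) => Soo.
have t0 k : 0 <= x * `|q k - q k.+1|%:E by rewrite mule_ge0 ?lee_fin// ltW.
have Sfin : S \is a fin_num by rewrite ge0_fin_numE// nneseries_ge0.
have c0 : (0 < fine x)%R by rewrite fine_gt0// x0 ltey_eq xfin.
rewrite (_ : q = fun k => (q 0%N + series (telescope q) k)%R); last first.
  by apply/funext => k; exact: eq_sum_telescope.
apply: is_cvgD; first exact: is_cvg_cst.
apply: normed_cvg; apply: nondecreasing_is_cvgn.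
  by apply: nondecreasing_series => k _ _; exact: normr_ge0.
exists (fine S / fine x)%R => _ [k _ <-].
rewrite ler_pdivlMr// -lee_fin (fineK Sfin).
apply: le_trans (nneseries_lim_ge k (fun n _ _ => t0 n)).
rewrite /series/= mulr_suml -sumEFin; apply: lee_sum => i _.
by rewrite -[in leRHS](fineK xfin) -EFinM lee_fin /telescope/= mulrC distrC.
Qed.

Lemma cvg0_cancel (x : \bar R) (q : nat -> R) : 0 < x -> x \is a fin_num ->
  x * (q k)%:E @[k --> \oo] --> 0 -> q @ \oo --> (0%R : R).
Proof.
move=> x0 xfin; have c0 : (0 < fine x)%R by rewrite fine_gt0// x0 ltey_eq xfin.
rewrite -(fineK xfin) => /fine_cvgP[_ /= H].
rewrite (_ : q = fun k => ((fine x)^-1 * (fine x * q k))%R); last first.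
  by apply/funext => k; rewrite mulKf// gt_eqF.
by rewrite -(mulr0 (fine x)^-1%R); apply: cvgMr.
Qed.

Lemma cvg_of_dist0 (x y : nat -> R) (l : R) :
  `|x k - y k|%R @[k --> \oo] --> (0%R : R) -> x @ \oo --> l -> y @ \oo --> l.
Proof.
move=> /norm_cvg0P xy xl.
rewrite (_ : y = fun k => (x k - (x k - y k))%R); last first.
  by apply/funext => k; rewrite subKr.
by rewrite -(subr0 l); apply: cvgB.
Qed.

(* Coercivity of the Young gap keeps the points [s k] bounded along a
   subsequence, and lower semicontinuity passes to the limit. *)
Lemma young_gap_limit (g : R -> \bar R) (r l : R) (s v : nat -> R) : Gamma g ->
  fin_near (econj g) r ->
  (forall k, g (s k) <= (r * s k - fine (econj g r) + v k)%:E) ->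
  recip (s k) @[k --> \oo] --> l ->
  limn_einf (fun k => (v k)%:E) < +oo ->
  l != 0%R /\ forall x : R, limn_einf (fun k => (v k)%:E) < x%:E ->
    g (l^-1 - 1)%R <= (r * (l^-1 - 1) - fine (econj g r) + x)%:E.
Proof.
move=> gG ur gs sl voo; have u := fin_near_fin ur.
have [e e0 /(econj_fin gG) ue] := (fin_nearP gG r).1 ur.
have s0 k : (0 <= s k)%R := Gamma_fin_ge0 gG (gap_fin gG (gs k)).
have sub x : limn_einf (fun k => (v k)%:E) < x%:E -> exists j : nat -> nat,
    recip (s (j k)) @[k --> \oo] --> l /\
    forall k, g (s (j k)) <= (r * s (j k) - fine (econj g r) + x)%:E.
  move=> /limn_einf_lt_frequently[j Hj]; exists j; split.
    by apply: (cvg_subseq (fun k => (Hj k).1) sl).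
  move=> k; apply: le_trans (gs _) _; rewrite lee_fin lerD2l ltW//.
  by rewrite -lte_fin (Hj k).2.
have l0 : l != 0%R.
  have [x vx] : exists x : R, limn_einf (fun k => (v k)%:E) < x%:E.
    move: voo; case: limn_einf => [y||]// _; last by exists 0%R; exact: ltNyr.
    by exists (y + 1)%R; rewrite lte_fin ltrDl.
  have [j [jl jg]] := sub _ vx.
  (* Coercivity bounds the points by [B], so their coordinates stay above [(1 + B)^-1] and [l]
     cannot be 0. *)
  pose B : R := `|(fine (econj g (r + e)) - fine (econj g r) + x) / e|%R.
  have B0 : (0 <= B)%R := normr_ge0 _.
  have sB k : (s (j k) <= B)%R.
    apply: le_trans (ler_norm _); rewrite ler_pdivlMr// mulrC.
    exact: (coercive gG u ue (jg k)).
  rewrite gt_eqF//; apply: (@lt_le_trans _ _ (1 + B)^-1%R).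
    by rewrite invr_gt0 ltr_pwDl.
  apply: (cvgr_to_ge jl); apply: nearW => k.
  by rewrite /recip ger0_norm// lef_pV2 ?posrE ?ltr_pwDl// lerD2l.
split=> // x vx; have [j [jl jg]] := sub _ vx.
have sj := recip_cvg_pos (fun k => s0 (j k)) l0 jl.
apply: (Gamma_lsc_cvg gG sj _ jg).
by apply: cvgD; [apply: cvgB; [exact: cvgMr | exact: cvg_cst] | exact: cvg_cst].
Qed.

End limits_of_sequences.

(** Here [x] and [C] are the suboptimalities of the two parameters of a blend. An [x] of order
    [t * k] leaves only [C + k] after division by the weight [t]. *)
Lemma blend_weight_bound {R : realType} (t x C k : R) : (0 < t <= 1)%R ->
  (0 <= x <= t * k)%R -> ((1 - t) * x + t * C <= t * (C + k))%R.
Proof.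
move=> /andP[t0 t1] /andP[x0 xk].
have : (0 <= t * x)%R by rewrite mulr_ge0// ltW.
lra.
Qed.

(** * The generalized primal solution *)

Section solution.
Context {d : measure_display} {Z : measurableType d} {R : realType} {n : nat}.
Variables (mu : {measure set Z -> \bar R}) (phi : Z -> 'rV[R]_n)
  (beta : Z -> R -> \bar R) (a : 'rV[R]_n).
Hypotheses (phi_meas : forall i : 'I_n, measurable_fun setT (fun z => phi z 0%R i))
  (betaB : Bclass beta) (Ka_fin : Kconj mu phi beta a \is a fin_num).
Variables (G : Z -> \bar R) (mG : measurable_fun setT G) (G0 : forall z, 0 < G z)
  (Goo : \int[mu]_z G z < +oo).
Implicit Types (vartheta : 'rV[R]_n).

Local Notation KK := (K mu phi beta).
Local Notation Th := (Theta mu phi beta).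
Local Notation bG := (Bclass_Gamma betaB).
Local Notation so := (subopt mu phi beta a).
Local Notation ff := (primal phi beta).
Local Notation rd := (rdist phi beta).

(** The cap on [e k] also makes the suboptimalities themselves summable, as the uniqueness argument
    requires. *)
Lemma oscillation_scale : exists e : nat -> R, forall k,
  [/\ (0 < e k)%R, (e k <= 1 / (2 ^ k.+1)%:R)%R &
    forall theta theta', Th theta -> Th theta' ->
      (so theta <= e k)%R -> (so theta' <= e k)%R ->
      \int[mu]_z (G z * (rd theta theta' z)%:E) <= (1 / (2 ^ k.+1)%:R)%:E].
Proof.
suff H k : exists e : R, [/\ (0 < e)%R, (e <= 1 / (2 ^ k.+1)%:R)%R &
    forall theta theta', Th theta -> Th theta' ->
      (so theta <= e)%R -> (so theta' <= e)%R ->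
      \int[mu]_z (G z * (rd theta theta' z)%:E) <= (1 / (2 ^ k.+1)%:R)%:E].
  by have [e He] := choice H; exists e.
have p0 : (0 < 1 / (2 ^ k.+1)%:R :> R)%R by rewrite divr_gt0// ltr0n expn_gt0.
have [e e0 He] := oscillation phi_meas betaB Ka_fin mG G0 Goo p0.
exists (Num.min e (1 / (2 ^ k.+1)%:R)%R); split.
- by rewrite lt_min e0.
- by rewrite ge_min lexx orbT.
- move=> t t' Tt Tt' st st'; apply: He => //.
  + by apply: le_trans st _; rewrite ge_min lexx.
  + by apply: le_trans st' _; rewrite ge_min lexx.
Qed.

Variables (e : nat -> R) (He : forall k,
  [/\ (0 < e k)%R, (e k <= 1 / (2 ^ k.+1)%:R)%R &
    forall theta theta', Th theta -> Th theta' ->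
      (so theta <= e k)%R -> (so theta' <= e k)%R ->
      \int[mu]_z (G z * (rd theta theta' z)%:E) <= (1 / (2 ^ k.+1)%:R)%:E]).
Variables (theta : nat -> 'rV[R]_n) (Ttheta : forall k, Th (theta k))
  (s1 : forall k, (so (theta k) <= e k)%R)
  (s2 : forall k, (so (theta k.+1) <= e k)%R).

(** The upper limit gives measurability at once; almost everywhere it turns out to be a finite
    limit. *)
Definition gen_primal z : R := fine (limn_esup (fun k => (ff (theta k) z)%:E)).

Lemma measurable_gen_primal : measurable_fun setT gen_primal.
Proof.
apply: measurableT_comp; first exact: fine_measurable.
apply: measurable_fun_limn_esup => k; apply/measurable_EFinP.
exact: measurable_primal.
Qed.

Lemma weighted_ge0 t t' z : 0 <= G z * (rd t t' z)%:E.
Proof. by apply: mule_ge0; [exact: ltW | rewrite lee_fin /rdist]. Qed.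

Lemma measurable_weighted t t' : measurable_fun setT (fun z => G z * (rd t t' z)%:E).
Proof.
by apply: emeasurable_funM => //; exact/measurable_EFinP/measurable_rdist.
Qed.

Lemma ae_cvg_recip : {ae mu, forall z, cvgn (fun k => recip (ff (theta k) z))}.
Proof.
have := @ae_summable _ _ _ mu (fun k z => G z * (rd (theta k) (theta k.+1) z)%:E)
  1%R ler01 (fun k => weighted_ge0 _ _) (fun k => measurable_weighted _ _).
have He' k : \int[mu]_z (G z * (rd (theta k) (theta k.+1) z)%:E) <=
    (1 / (2 ^ k.+1)%:R)%:E.
  have [_ _ HG] := He k; exact: HG (Ttheta k) (Ttheta k.+1) (s1 k) (s2 k).
move=> /(_ He'); apply: filterS2 (G_fin mG G0 Goo) => z Gz; exact: cvg_summable_steps.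
Qed.

(* Perturbing near-optimal parameters towards [vartheta] by small weights [t k]
   keeps them near-optimal, while the Jensen gaps divided by [t k] converge to
   at least the Young gap of the limit. *)
Lemma perturbation vartheta : Th vartheta ->
  exists (t : nat -> R) (th : nat -> 'rV[R]_n), forall k,
    [/\ (0 < t k <= 1)%R, Th (th k), Th (blend (t k) (th k) vartheta),
      (so (blend (t k) (th k) vartheta) <= e k)%R &
      \int[mu]_z ((t k)^-1 * `|jensen_gap phi beta (t k) (th k) vartheta z|)%:E <=
        (so vartheta + k.+1%:R^-1)%:E].
Proof.
move=> Tv; have C0 := subopt_ge0 Ka_fin (proj1 Tv).
set C := so vartheta in C0 *.
(* With [t k * (1 + C) = e k / 2], the blend is [e k]-optimal. *)
pose t k : R := (e k / (2 * (1 + C)))%R.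
have D0 : (0 < 2 * (1 + C))%R by rewrite mulr_gt0// ltr_pwDl.
have e0 k : (0 < e k)%R by have [] := He k.
have e1 k : (e k <= 1)%R.
  have [_ /le_trans + _] := He k; apply.
  by rewrite ler_pdivrMr ?mul1r ?ler1n ?expn_gt0// ltr0n expn_gt0.
have t0 k : (0 < t k)%R by rewrite divr_gt0.
have te k : (t k * (1 + C) = e k / 2)%R.
  by rewrite /t invfM mulrA mulfVK// gt_eqF// ltr_pwDl.
have t1 k : (t k <= e k / 2)%R by rewrite -te ler_peMr ?lerDl// ltW.
have t01 k : (0 < t k <= 1)%R.
  by rewrite t0/= (le_trans (t1 k))// ler_pdivrMr// mul1r (le_trans (e1 k))// ler1n.
have k0 k : (0 < k.+1%:R^-1 :> R)%R by rewrite invr_gt0 ltr0n.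
have k1 k : (k.+1%:R^-1 <= 1 :> R)%R by rewrite invf_le1 ?ler1n ?ltr0n.
(* A new sequence, independent of [theta], whose suboptimality is small even relative to the weight
   [t k]. *)
have H k : exists th, Th th /\ (so th <= t k * k.+1%:R^-1)%R.
  have p0 : (0 < t k * k.+1%:R^-1)%R by rewrite mulr_gt0.
  have [th Tth sth] := Theta_approx phi_meas betaB Ka_fin Tv p0.
  by exists th.
have [th Hth] := choice H; exists t, th => k.
have [Tth sth] := Hth k; have [t0k t1k] := andP (t01 k).
have l01 : (0 <= t k <= 1)%R by rewrite (ltW t0k).
have s0 := subopt_ge0 Ka_fin (proj1 Tth).
have bound : ((1 - t k) * so (th k) + t k * C <= t k * (C + k.+1%:R^-1))%R.
  by apply: blend_weight_bound (t01 k) _; rewrite s0.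
split.
- exact: t01.
- exact: Tth.
- exact: (Theta_blend phi_meas betaB Ka_fin (t01 k) (proj1 Tth) Tv).
- apply: le_trans (subopt_blend phi_meas betaB Ka_fin l01 (proj1 Tth) (proj1 Tv)) _.
  apply: le_trans bound _; apply: (@le_trans _ _ (e k / 2)%R).
    by rewrite -te ler_pM2l// addrC lerD2r.
  by rewrite ler_pdivrMr// ler_peMr ?ler1n// ltW.
- under eq_integral do rewrite EFinM.
  rewrite ge0_integralZl//; last 2 first.
  + apply/measurable_EFinP; apply: measurableT_comp => //; exact: measurable_jensen_gap.
  + by rewrite lee_fin invr_ge0 ltW.
  have := jensen_gap_integral_le phi_meas betaB Ka_fin l01 (proj1 Tth) (proj1 Tv).
  move=> /(lee_wpmul2l _) le; apply: le_trans (le _ _) _.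
    by rewrite lee_fin invr_ge0 ltW.
  by rewrite -EFinM lee_fin ler_pdivrMl.
Qed.

(** The condition [l != 0] excludes escape to infinity, and [l^-1 - 1] inverts the coordinate
    [recip]. *)
Definition is_gen_primal z : Prop := exists l : R, [/\ l != 0%R,
  recip (ff (theta k) z) @[k --> \oo] --> l & gen_primal z = (l^-1 - 1)%R].

Lemma gen_primal_Bregman vartheta : Th vartheta ->
  {ae mu, forall z, is_gen_primal z} /\
  Bregman mu beta gen_primal (f_ phi beta vartheta) <= (so vartheta)%:E.
Proof.
move=> Tv; have [t [th H]] := perturbation Tv.
pose w k := blend (t k) (th k) vartheta.
pose V z k : R := ((t k)^-1 * `|jensen_gap phi beta (t k) (th k) vartheta z|)%R.
have Tw k : Th (w k) by have [] := H k.
have mV k : measurable_fun setT (fun z => (V z k)%:E).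
  apply/measurable_EFinP; apply: measurable_funM; first exact: measurable_cst.
  by apply: measurableT_comp => //; exact: measurable_jensen_gap.
have V0 k z : 0 <= (V z k)%:E.
  have [/andP[t0 _] _ _ _ _] := H k.
  by rewrite lee_fin mulr_ge0// invr_ge0 ltW.
pose Phi z := limn_einf (fun k => (V z k)%:E).
have Phi0 z : 0 <= Phi z.
  by rewrite /Phi limn_einf_lim; apply: lime_ge; [exact: is_cvg_einfs |
    apply: nearW => k; apply: le_ereal_inf_tmp => _ [j _ <-]; exact: V0].
have mPhi : measurable_fun setT Phi.
  rewrite (_ : Phi = fun z => - limn_esup (fun k => - (V z k)%:E)); last first.
    by apply/funext => z; rewrite /Phi -limn_einfN; congr limn_einf;
      apply/funext => k; rewrite /comp oppeK.
  apply: measurableT_comp => //; apply: measurable_fun_limn_esup => k.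
  exact: measurableT_comp.
have IPhi : \int[mu]_z Phi z <= (so vartheta)%:E.
  apply: le_trans (fatou mu measurableT mV (fun k z _ => V0 k z)) _.
  apply: (@limn_einf_le_cvg _ _ (fun k => (so vartheta + k.+1%:R^-1)%:E)).
    by move=> k; have [] := H k.
  apply: cvg_EFin; first exact: nearW.
  rewrite -[X in _ --> X]addr0; apply: cvgD; first exact: cvg_cst.
  exact: cvg_harmonic.
have Phioo : {ae mu, forall z, Phi z < +oo}.
  by apply: ae_fin_of_integral => //; apply: le_lt_trans IPhi _; rewrite ltry.
(* Both [theta k] and [w k] are [e k]-optimal, so the perturbed functions have the same limit,
   whatever [vartheta] is. *)
have close : {ae mu, forall z,
    G z * (rd (theta k) (w k) z)%:E @[k --> \oo] --> 0}.
  apply: (@ae_cvg0_of_summable _ _ _ mu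
    (fun k z => G z * (rd (theta k) (w k) z)%:E) 1%R) => [//|k z|k|k].
  - exact: weighted_ge0.
  - exact: measurable_weighted.
  - have [_ _ HG] := He k; have [_ _ _ sw _] := H k.
    exact: HG (Ttheta k) (Tw k) (s1 k) sw.
have amw : {ae mu, forall z, forall k,
    is_argmax (beta z) (dot (w k) (phi z)) (ff (w k) z)}.
  by apply: ae_foralln => k; apply: filterS (ae_primal betaB (Tw k)) => z [].
have amt : {ae mu, forall z, forall k,
    is_argmax (beta z) (dot (theta k) (phi z)) (ff (theta k) z)}.
  by apply: ae_foralln => k; apply: filterS (ae_primal betaB (Ttheta k)) => z [].
have fth : {ae mu, forall z, forall k,
    econj (beta z) (dot (th k) (phi z)) \is a fin_num}.
  apply: ae_foralln => k; have [_ Tth _ _ _] := H k.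
  by apply: filterS (ae_primal betaB Tth) => z [/fin_near_fin].
have core : {ae mu, forall z, is_gen_primal z /\
    bregman (beta z) (gen_primal z) (f_ phi beta vartheta z) <= Phi z}.
  apply: filterS3 (filterI (filterI amw amt) (filterI fth close))
    (filterI (G_fin mG G0 Goo) Phioo) (filterI ae_cvg_recip (ae_primal betaB Tv)).
  move=> z [[aw at_] [ft cl]] [Gz Pz] [cr [nv av fE]].
  have gG := bG z.
  set l := limn (fun k => recip (ff (theta k) z)) in cr.
  have crl : recip (ff (theta k) z) @[k --> \oo] --> l := cr.
  have wl : recip (ff (w k) z) @[k --> \oo] --> l.
    by apply: (cvg_of_dist0 _ crl); exact: cvg0_cancel (G0 z) Gz cl.
  have gap k : beta z (ff (w k) z) <= (dot vartheta (phi z) * ff (w k) z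
      - fine (econj (beta z) (dot vartheta (phi z))) + V z k)%:E.
    have [/andP[t0 t1] _ _ _ _] := H k.
    have l01 : (0 <= t k <= 1)%R by rewrite (ltW t0).
    have [+ _] := jensen_gap_Young gG l01 (dot_blend (t k) (th k) vartheta (phi z))
      (ft k) (fin_near_fin nv) (aw k).
    move=> /(_ t0) /le_trans; apply; rewrite lee_fin lerD2l /V mulrC.
    by rewrite ler_pM2l ?invr_gt0//; exact: ler_norm.
  have [l0 Hl] := young_gap_limit gG nv gap wl Pz.
  have hE : gen_primal z = (l^-1 - 1)%R.
    have fl := recip_cvg_pos (fun k => argmax_ge0 gG (at_ k)) l0 crl.
    have fl' : (ff (theta k) z)%:E @[k --> \oo] --> (l^-1 - 1)%:E.
      by apply: cvg_EFin => //; exact: nearW.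
    by rewrite /gen_primal (cvg_limn_einf_sup fl').2.
  split; first exact: (ex_intro _ l (And3 l0 crl hE)).
  (* The limit bound on the Young gap holds at levels strictly above [Phi z], hence the slack
     [x]. *)
  rewrite fE hE; apply/lee_addgt0Pr => x x0.
  have Pfin : Phi z \is a fin_num by rewrite ge0_fin_numE.
  rewrite -(fineK Pfin) -EFinD; apply: (bregman_le_gap gG av); apply: Hl.
  by rewrite -/(Phi z) -(fineK Pfin) lte_fin ltrDl.
split; first by apply: filterS core => z [].
apply: le_trans _ (IPhi); apply: uintegral_le => //.
- by apply: filterS core => z [].
- by apply: le_lt_trans IPhi _; rewrite ltry.
Qed.

End solution.

(** * Uniqueness of the generalized primal solution *)

Section uniqueness.
Context {d : measure_display} {Z : measurableType d} {R : realType} {n : nat}.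
Variables (mu : {measure set Z -> \bar R}) (phi : Z -> 'rV[R]_n)
  (beta : Z -> R -> \bar R) (a : 'rV[R]_n).
Hypotheses (phi_meas : forall i : 'I_n, measurable_fun setT (fun z => phi z 0%R i))
  (betaB : Bclass beta).
Variables (theta : nat -> 'rV[R]_n).
Hypotheses (Ttheta : forall k, Theta mu phi beta (theta k))
  (s0 : forall k, (subopt mu phi beta a (theta k) <= 1 / (2 ^ k.+1)%:R)%R).

Local Notation ff := (primal phi beta).
Local Notation bG := (Bclass_Gamma betaB).

(* A measurable minorant of the Bregman integrand, which itself need not be
   known to be measurable. *)
Definition bregman_minorant (h : Z -> R) k z : \bar R :=
  if (h z < 0)%R then +oo else
  maxe 0 (beta z (h z) + beta z (ff (theta k) z)
    - 2%:E * beta z ((h z + ff (theta k) z) / 2)%R).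

Lemma measurable_bregman_minorant h k : measurable_fun setT h ->
  measurable_fun setT (bregman_minorant h k).
Proof.
move=> mh; have mf := measurable_primal phi_meas betaB (theta k).
apply: measurable_fun_ifT.
- by apply: measurable_fun_ltr => //; exact: measurable_cst.
- exact: measurable_cst.
- apply: measurable_maxe; first exact: measurable_cst.
  apply: emeasurable_funB.
    by apply: emeasurable_funD; exact: measurable_Bclass_comp.
  apply: emeasurable_funM; first exact: measurable_cst.
  apply: measurable_Bclass_comp => //.
  by apply: measurable_funM; [exact: measurable_funD | exact: measurable_cst].
Qed.

Lemma bregman_minorant_le h k : {ae mu, forall z,
  bregman_minorant h k z <= bregman (beta z) (h z) (f_ phi beta (theta k) z)}.
Proof.
apply: filterS (ae_primal betaB (Ttheta k)) => z [_ am ->].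
rewrite /bregman_minorant; have [h0|h0] := ltP (h z) 0%R.
  by rewrite /bregman h0.
have le := defect_le_bregman (bG z) am h0.
rewrite ge_max le andbT; apply: le_trans _ le.
by have := defect_ge0 (bG z) h0 (argmax_fin (bG z) am).
Qed.

(** The minorants have summable integrals and tend to 0 almost everywhere. Small midpoint defects
    then force [recip (ff (theta k) z)] to converge to [recip (h z)]. *)
Lemma gen_primal_unique h : measurable_fun setT h ->
  (forall k, Bregman mu beta h (f_ phi beta (theta k))
    <= (subopt mu phi beta a (theta k))%:E) ->
  {ae mu, forall z, is_gen_primal phi beta theta z} ->
  {ae mu, forall z, h z = gen_primal phi beta theta z}.
Proof.
move=> mh Bh gs.
have m0 k z : 0 <= bregman_minorant h k z.
  by rewrite /bregman_minorant; case: ifP => // _; rewrite le_max lexx.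
have mI k : \int[mu]_z bregman_minorant h k z <= (1 / (2 ^ k.+1)%:R)%:E.
  apply: (@le_trans _ _ (subopt mu phi beta a (theta k))%:E); last first.
    by rewrite lee_fin; exact: s0.
  apply: le_trans _ (Bh k); apply: le_uintegral (m0 k) _ (bregman_minorant_le h k).
  exact: measurable_bregman_minorant.
have m_cvg := ae_cvg0_of_summable ler01 m0
  (fun k => measurable_bregman_minorant k mh) mI.
have am : {ae mu, forall z, forall k,
    is_argmax (beta z) (dot (theta k) (phi z)) (ff (theta k) z)}.
  by apply: ae_foralln => k; apply: filterS (ae_primal betaB (Ttheta k)) => z [].
apply: filterS3 gs am m_cvg => z [l [l0 fl ->]] am mc.
have h0 : (0 <= h z)%R.
  (* A negative [h z] would make every minorant [+oo], against convergence to 0. *)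
  rewrite leNgt; apply/negP => hz.
  move: mc => /fine_cvgP[[N _ HN] _]; have := HN N (leqnn N).
  by rewrite /bregman_minorant hz.
have ql : recip (h z) = l.
  suff : recip (ff (theta k) z) @[k --> \oo] --> recip (h z).
    by move=> fh; apply: cvg_unique fh fl.
  apply/cvgrPdist_lt => eta eta0.
  have [dl dl0 Hd] := defect_recip (bG z) eta0.
  have N : nbhs (0 : \bar R) [set y | y < dl%:E].
    by apply: open_nbhs_nbhs; split; [exact: open_ereal_lt_ereal | rewrite /= lte_fin].
  have : \forall k \near \oo, bregman_minorant h k z < dl%:E by exact: (mc _ N).
  apply: filterS => k; rewrite /bregman_minorant (ltNge (h z)) h0/= gt_max.
  move=> /andP[_ /ltW dk].
  have fk0 := argmax_ge0 (bG z) (am k).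
  apply: Hd => //.
  have m_ge0 : (0 <= (h z + ff (theta k) z) / 2)%R.
    by rewrite divr_ge0// addr_ge0.
  have [mf|] := boolP (beta z ((h z + ff (theta k) z) / 2)%R \is a fin_num).
    by move: dk; rewrite leeBlDr ?fin_numM// (addeC dl%:E).
  move=> /(Gamma_nfin_at0 (bG z) m_ge0)[_ ->].
  by rewrite gt0_muley ?lte_fin// addye// leey.
by rewrite -ql recipK.
Qed.

End uniqueness.

Theorem theorem9p5 (d : measure_display) (Z : measurableType d) (R : realType)
    (mu : {sigma_finite_measure set Z -> \bar R})
    (n : nat) (phi : Z -> 'rV[R]_n)
    (phi_meas : forall i : 'I_n, measurable_fun setT (fun z => phi z 0%R i))
    (beta : Z -> R -> \bar R) (beta_B : Bclass beta)
    (DCQ : Theta mu phi beta !=set0)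
    (a : 'rV[R]_n) (Ka_fin : Kconj mu phi beta a \is a fin_num) :
  exists h : Z -> R,
    [/\ measurable_fun setT h,
        forall theta, Theta mu phi beta theta ->
          Bregman mu beta h (f_ phi beta theta) <=
          Kconj mu phi beta a - ((dot theta a)%:E - K mu phi beta theta)
      & forall h' : Z -> R,
          measurable_fun setT h' ->
          (forall theta, Theta mu phi beta theta ->
            Bregman mu beta h' (f_ phi beta theta) <=
            Kconj mu phi beta a - ((dot theta a)%:E - K mu phi beta theta)) ->
          {ae mu, forall z, h' z = h z}].
Proof.
have [G [mG G0 Goo]] := exists_weight mu.
have [e He] := oscillation_scale phi_meas beta_B Ka_fin mG G0 Goo.
have e0 k : (0 < e k)%R by have [] := He k.
have [vartheta Tv] := DCQ.
have H k : exists theta, Theta mu phi beta theta /\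
    (* The bound by [e k.-1], read at index [k.+1], makes [theta k] and [theta k.+1] both
       [e k]-optimal. *)
    (subopt mu phi beta a theta <= Num.min (e k) (e k.-1))%R.
  have m0 : (0 < Num.min (e k) (e k.-1))%R by rewrite lt_min !e0.
  have [theta Tt st] := Theta_approx phi_meas beta_B Ka_fin Tv m0.
  by exists theta.
have [theta Htheta] := choice H.
have Ttheta k : Theta mu phi beta (theta k) := (Htheta k).1.
have s1 k : (subopt mu phi beta a (theta k) <= e k)%R.
  by apply: le_trans (Htheta k).2 _; rewrite ge_min lexx.
have s2 k : (subopt mu phi beta a (theta k.+1) <= e k)%R.
  by apply: le_trans (Htheta k.+1).2 _; rewrite ge_min lexx orbT.
(* The sequence [theta] is fixed before the parameter of the inequality, so a single function serves
   all of [Theta]. *)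
have sol := gen_primal_Bregman phi_meas beta_B Ka_fin mG G0 Goo He Ttheta s1 s2.
exists (gen_primal phi beta theta); split.
- exact: measurable_gen_primal.
- by move=> t Tt; rewrite (suboptE Ka_fin (proj1 Tt)); exact: (sol t Tt).2.
- move=> h mh Bh; apply: (gen_primal_unique phi_meas beta_B Ttheta _ mh).
  + by move=> k; have [_ ek _] := He k; exact: le_trans (s1 k) ek.
  + by move=> k; rewrite -(suboptE Ka_fin (proj1 (Ttheta k))); exact: Bh.
  + exact: (sol vartheta Tv).1.
Qed.
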